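(* Fix integers $\alpha\ge 0$, $m\ge 1$ with $\alpha+m\le n$, let $S=[\alpha+1,\alpha+m]$, and let $r$ be an integer with $0\le r<m$. A monomial $\mathbf m=\prod_{i=1}^d[\mathbf a^{(i)}]\in R(k,n)$ lies in $\operatorname{In}_\omega(\mathcal J_{S\le r})$ if and only if (1) for some $i,j\in[d]$ the sets $\mathbf a^{(i)}$ and $\mathbf a^{(j)}$ are incomparable in the Plücker poset, or (2) $\mathbf m$ is a standard monomial containing a generalized antidiagonal of size $r+1$ with entries in $S$. In particular, a monomial $\mathbf m$ is a minimal generator of $\operatorname{In}_\omega(\mathcal J_{S\le r})$ if and only if $\mathbf m$ satisfies (1) or (2) and every monomial strictly dividing $\mathbf m$ satisfies neither (1) nor (2).
   Context: Let $\Bbbk$ be an algebraically closed field of characteristic $0$ and fix integers $1\le k<n$. $\mathrm{Gr}(k,n)$ is the Grassmannian of $k$-dimensional subspaces of $\Bbbk^n$; a point $V$ is represented by a $k\times n$ matrix with row span $V$. For $\mathbf a=\{a_1<\dots<a_k\}\subseteq[n]$, $[\mathbf a]$ denotes the Plücker coordinate (the maximal minor on columns $\mathbf a$). $R(k,n)=\Bbbk[[\mathbf a]:\mathbf a\in\binom{[n]}{k}]$ is the polynomial ring with one variable per $k$-subset; for a subvariety $X\subseteq\mathrm{Gr}(k,n)$ its defining ideal is the homogeneous ideal of polynomials in $R(k,n)$ vanishing on $X$ under the Plücker embedding. The Plücker poset is $\binom{[n]}{k}$ with $\mathbf a\le\mathbf b$ iff $a_i\le b_i$ for all $i$. $<_\omega$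 is the degree reverse lexicographic monomial order on $R(k,n)$ with respect to an ordering of the variables that is a fixed linear extension of the Plücker poset (poset-larger variables are larger); $\operatorname{In}_\omega(\cdot)$ is the initial ideal. For $S\subseteq[n]$ and $r\ge0$, $X_{S\le r}=\{V\in\mathrm{Gr}(k,n):\text{the columns of a representing matrix indexed by }S\text{ span a space of dimension}\le r\}$ and $\mathcal J_{S\le r}\subseteq R(k,n)$ is its defining ideal. A standard monomial is a product $\prod_{i=1}^d[\mathbf a^{(i)}]$ of pairwise comparable variables, ordered so that $\mathbf a^{(1)}\le\dots\le\mathbf a^{(d)}$, with $\mathbf a^{(i)}=\{a^{(i)}_1<\dots<a^{(i)}_k\}$ (viewed as a semistandard $k\times d$ tableau whose $i$-th column is $\mathbf a^{(i)}$). A generalized antidiagonal of size $\ell$ with entries in $S=[\alpha+1,\alpha+m]$ of such a standard monomial is a sequence $a^{(\sigma_\ell)}_{\rho_1},a^{(\sigma_{\ell-1})}_{\rho_2},\dots,a^{(\sigma_1)}_{\rho_\ell}$ with $\alpha+1\le a^{(\sigma_\ell)}_{\rho_1}<a^{(\sigma_{\ell-1})}_{\rho_2}<\dots<a^{(\sigma_1)}_{\rho_\ell}\le\alpha+m$, $1\le\sigma_1\le\sigma_2\le\dots\le\sigma_\ell\le d$, and $1\le\rho_1<\rho_2<\dots<\rho_\ell\le k$. *)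

(* Defs.v *)
From HB Require Import structures.
From mathcomp Require Import all_boot all_order all_algebra.
From mathcomp Require Import mpoly.

Set Implicit Arguments.
Unset Strict Implicit.
Unset Printing Implicit Defensive.

Import GRing.Theory.
Local Open Scope ring_scope.

(* Conventions: [n] = {1,...,n} is modelled by 'I_n = {0,...,n-1}
   (the element i+1 of [n] is the ordinal with value i).  All comparisons
   between elements are order-preserving under this shift. *)

Definition ksub (n k : nat) := {A : {set 'I_n} | #|A| == k}.

Definition nvars (n k : nat) : nat := #|{: ksub n k}|.

(* The variable [a] of R(k,n) = {mpoly F[nvars n k]}. *)
Definition Pvar (n k : nat) (a : ksub n k) : 'I_(nvars n k) := enum_rank a.

Definition elems (n k : nat) (a : ksub n k) : seq nat :=
  sort leq [seq val x | x <- enum (val a)].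

Definition ent (n k : nat) (a : ksub n k) (i : nat) : nat := nth 0 (elems a) i.

Definition pl_le (n k : nat) (a b : ksub n k) : bool :=
  [forall i : 'I_k, ent a i <= ent b i]%N.

Definition pl_comparable (n k : nat) (a b : ksub n k) : bool :=
  pl_le a b || pl_le b a.

(* Submatrix of M on the columns given by naturals f j (all < n). *)
Definition colsub_nat (F : fieldType) (k n p : nat) (M : 'M[F]_(k, n))
  (f : 'I_p -> nat) : 'M[F]_(k, p) :=
  \matrix_(i < k, j < p)
     (match @insub nat (fun x => x < n)%N _ (f j) with
      | Some c => M i c | None => 0 end).

Definition pluck (F : fieldType) (k n : nat) (M : 'M[F]_(k, n)) (a : ksub n k) : F :=
  \det (colsub_nat M (fun j : 'I_k => ent a j)).

Definition pluckv (F : fieldType) (k n : nat) (M : 'M[F]_(k, n)) :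
  'I_(nvars n k) -> F := fun x => pluck M (enum_val x).

(* Columns indexed by S = [alpha+1, alpha+m] (0-based: alpha, ..., alpha+m-1). *)
Definition colS (F : fieldType) (k n : nat) (alpha m : nat) (M : 'M[F]_(k, n)) :
  'M[F]_(k, m) := colsub_nat M (fun j : 'I_m => (alpha + j)%N).

(* The defining ideal J_{S <= r}: polynomials vanishing on (the affine cone
   over) X_{S<=r} under the Plücker embedding. *)
Definition Jideal (F : fieldType) (n k alpha m r : nat)
  (f : {mpoly F[nvars n k]}) : Prop :=
  forall M : 'M[F]_(k, n), (\rank (colS alpha m M) <= r)%N ->
    f.@[pluckv M] = 0.

(* w is a linear extension of the Plücker poset (w ranks the variables:
   larger rank = larger variable). *)
Definition linext (n k : nat) (w : ksub n k -> nat) : Prop :=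
  injective w /\ forall a b : ksub n k, pl_le a b -> (w a <= w b)%N.

(* Degree reverse lexicographic order w.r.t. the variable order w:
   drl_lt w m1 m2  means  x^m1 <_omega x^m2. *)
Definition drl_lt (n k : nat) (w : ksub n k -> nat)
  (m1 m2 : 'X_{1..nvars n k}) : Prop :=
  (mdeg m1 < mdeg m2)%N \/
  (mdeg m1 = mdeg m2 /\
   exists a : ksub n k,
     (m2 (Pvar a) < m1 (Pvar a))%N /\
     forall b : ksub n k, (w b < w a)%N -> m1 (Pvar b) = m2 (Pvar b)).

Definition is_lead (F : fieldType) (n k : nat) (w : ksub n k -> nat)
  (f : {mpoly F[nvars n k]}) (m : 'X_{1..nvars n k}) : Prop :=
  m \in msupp f /\
  forall m', m' \in msupp f -> m' <> m -> drl_lt w m' m.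

Definition initial_ideal (F : fieldType) (n k : nat) (w : ksub n k -> nat)
  (J : {mpoly F[nvars n k]} -> Prop) (p : {mpoly F[nvars n k]}) : Prop :=
  exists (l : nat) (q : 'I_l -> {mpoly F[nvars n k]})
         (lm : 'I_l -> 'X_{1..nvars n k}),
    (forall i, exists f, J f /\ f != 0 /\ is_lead w f (lm i)) /\
    p = \sum_(i < l) q i * 'X_[lm i].

Definition colseq (n k : nat) (m : 'X_{1..nvars n k}) : seq (ksub n k) :=
  flatten [seq nseq (m (Pvar a)) a | a <- enum {: ksub n k}].

Definition cond1 (n k : nat) (m : 'X_{1..nvars n k}) : Prop :=
  exists a b : ksub n k,
    (0 < m (Pvar a))%N /\ (0 < m (Pvar b))%N /\ ~~ pl_comparable a b.

Definition standard (n k : nat) (m : 'X_{1..nvars n k}) : Prop :=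
  forall a b : ksub n k,
    (0 < m (Pvar a))%N -> (0 < m (Pvar b))%N -> pl_comparable a b.

(* The columns t = [a^(1); ...; a^(d)] (sorted) contain a generalized
   antidiagonal of size l with entries in S = [alpha+1, alpha+m].
   0-based: sig j = sigma_(j+1) - 1, rho j = rho_(j+1) - 1, and the
   (j+1)-th entry of the antidiagonal is a^(sigma_(l-j))_(rho_(j+1)). *)
Definition has_gad (n k : nat) (alpha m l : nat) (t : seq (ksub n k)) : Prop :=
  exists sig rho : nat -> nat,
    let e j := nth 0 (nth [::] (map (@elems n k) t) (sig (l.-1 - j)%N)) (rho j) in
    (forall j, j < l -> sig j < size t /\ rho j < k)%N /\
    (forall j, j.+1 < l -> sig j <= sig j.+1 /\ rho j < rho j.+1)%N /\
    (forall j, j < l -> alpha <= e j < alpha + m)%N /\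
    (forall j, j.+1 < l -> e j < e j.+1)%N.

Definition cond2 (n k : nat) (alpha m r : nat) (mo : 'X_{1..nvars n k}) : Prop :=
  standard mo /\
  exists t : seq (ksub n k),
    perm_eq t (colseq mo) /\ sorted (@pl_le n k) t /\ has_gad alpha m r.+1 t.

(* Main.v *)
Require Import Defs.
From mathcomp Require Import all_boot all_order all_algebra all_fingroup.
From mathcomp Require Import mpoly zify boolp.

Set Implicit Arguments.
Unset Strict Implicit.
Unset Printing Implicit Defensive.
Import Order.TTheory GRing.Theory.
Local Open Scope ring_scope.

(* Conditions (1) and (2) produce leading monomials by the same alternation. Take a
   family of entries e_1 < e_2 < ... of the tableau sitting in weakly decreasing columns
   and antisymmetrize the product of brackets over these entries: the result is
   alternating in the corresponding columns of the matrix, so it vanishes when these are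
   linearly dependent. Exchanging entries between columns makes the first modified column
   smaller in the Pluecker poset, so the original monomial leads. For (1) use the k+1
   entries b_1 < ... < b_i < a_i < ... < a_k, for (2) the antidiagonal.

   Conversely, by reduction it suffices that the standard monomials without such an
   antidiagonal are linearly independent on X_{S<=r}. Parametrize by
   M_ij = sum_l a_il b_lj, with r labels l for the columns in S and one private label for
   each other column. Without a generalized antidiagonal of size r+1 there is no chain of
   r+1 cells with entries in S, strictly increasing in row and entry, so the heights of
   the cells label them by antichains. Consider the monomial in the a and b given by this
   labelling. Among the fillings with the same row and column content in each label, the
   antichain labelling minimizes the number of cells in every south-east quadrant; among
   the terms of a product of brackets, the diagonal one maximizes it. Hence for a tableau
   with the largest total quadrant count in the support, this monomial comes only from
   its own diagonal term. *)

Section KSubsets.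
Variables n k : nat.
Implicit Types a b : ksub n k.

Lemma size_elems a : size (elems a) = k.
Proof. by rewrite size_sort size_map -cardE (eqP (valP a)). Qed.

Lemma sorted_elems a : sorted ltn (elems a).
Proof.
rewrite ltn_sorted_uniq_leq sort_uniq map_inj_uniq ?enum_uniq ?sort_sorted //.
exact: val_inj.
Qed.

Lemma mem_elems a (x : 'I_n) : (val x \in elems a) = (x \in val a).
Proof. by rewrite mem_sort (mem_map val_inj) mem_enum. Qed.

Lemma ltn_ent a i : (i < k)%N -> (ent a i < n)%N.
Proof.
move=> ik; have: ent a i \in elems a by rewrite mem_nth ?size_elems.
by rewrite mem_sort => /mapP[x _ ->]; apply: ltn_ord.
Qed.

Definition entry a (i : 'I_k) : 'I_n := Ordinal (ltn_ent a (ltn_ord i)).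

Lemma ltn_entry a (i j : 'I_k) : (entry a i < entry a j)%N = (i < j)%N.
Proof.
have homo : {homo entry a : i j / (i < j)%N}.
  by move=> ? ? ?; apply: (sorted_ltn_nth ltn_trans); rewrite ?sorted_elems ?inE ?size_elems.
apply/idP/idP => [|/homo //]; case: (ltngtP i j) => // [/homo/ltnW|/val_inj ->].
  by rewrite leqNgt => /negP.
by rewrite ltnn.
Qed.

Lemma leq_entry a (i j : 'I_k) : (entry a i <= entry a j)%N = (i <= j)%N.
Proof. by rewrite leqNgt ltn_entry -leqNgt. Qed.

Lemma entry_inj a : injective (entry a).
Proof.
by move=> i j ij; apply/val_inj/eqP; rewrite eqn_leq -!(leq_entry a) ij leqnn.
Qed.

Lemma ksubP a x : reflect (exists i, x = entry a i) (x \in val a).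
Proof.
rewrite -mem_elems; apply: (iffP idP) => [/(nthP 0%N)[i]|[i ->]].
  by rewrite size_elems => ik ix; exists (Ordinal ik); apply: val_inj.
by rewrite mem_nth // size_elems.
Qed.

Lemma mem_entry a i : entry a i \in val a.
Proof. by apply/ksubP; exists i. Qed.

Lemma ksub_eq_subset a b : val a \subset val b -> a = b.
Proof.
by move=> ab; apply/val_inj/eqP; rewrite eqEcard ab (eqP (valP a)) (eqP (valP b)) leqnn.
Qed.

Lemma eq_entry a b : entry a =1 entry b -> a = b.
Proof.
by move=> ab; apply: ksub_eq_subset; apply/subsetP => x /ksubP[i ->]; rewrite ab mem_entry.
Qed.

Lemma word_of_injective (g : 'I_k -> 'I_n) : injective g ->
  exists (a : ksub n k) (s : 'S_k), g =1 entry a \o s.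
Proof.
move=> g_inj.
have card_g : #|[set g i | i : 'I_k]| == k by rewrite card_imset // card_ord.
pose a : ksub n k := exist (fun A : {set 'I_n} => #|A| == k) _ card_g.
have mem_g i : exists j, g i = entry a j by apply/ksubP; rewrite /= imset_f.
have [f fE] := fin_all_exists mem_g.
have f_inj : injective f by move=> i j ij; apply: g_inj; rewrite !fE ij.
by exists a, (perm f_inj) => i; rewrite /= permE.
Qed.

Lemma mem_word (g : 'I_k -> 'I_n) a (s : 'S_k) x : g =1 entry a \o s ->
  reflect (exists i, x = g i) (x \in val a).
Proof.
move=> gE; apply: (iffP (ksubP a x)) => -[i ->].
  by exists (s^-1%g i); rewrite gE /= permKV.
by exists (s i); rewrite gE.
Qed.

Lemma word_unique a b (s t : 'S_k) : entry a \o s =1 entry b \o t -> a = b /\ s = t.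
Proof.
move=> st; have ab : a = b.
  apply: ksub_eq_subset; apply/subsetP => _ /ksubP[i ->].
  by rewrite -[i](permKV s) [entry _ _]st mem_entry.
by split=> //; apply/permP => i; have := st i; rewrite /= ab => /entry_inj.
Qed.

Lemma pl_leP a b : reflect (forall i, entry a i <= entry b i)%N (pl_le a b).
Proof. exact: forallP. Qed.

Lemma pl_le_refl : reflexive (@pl_le n k).
Proof. by move=> a; apply/pl_leP. Qed.

Lemma pl_le_trans : transitive (@pl_le n k).
Proof.
by move=> b a c /pl_leP ab /pl_leP bc; apply/pl_leP => i; apply: leq_trans (ab i) (bc i).
Qed.

Lemma leq_entry_card a i (x : 'I_n) :
  (entry a i <= x)%N = (i < #|[set y in val a | (y <= x)%N]|)%N.
Proof.
have -> : #|[set y in val a | (y <= x)%N]| = count (fun y => y <= x)%N (elems a).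
  rewrite count_sort count_map -size_filter cardE /enum_mem -filter_predI.
  by congr size; apply: eq_filter => y; rewrite !inE andbC.
have elems_le : sorted <=%O (elems a) by rewrite sort_sorted //; exact: leq_total.
have [lt|ge] := ltnP; first exact: nth_count_le lt.
apply/negbTE; rewrite -ltnNge; apply: (@nth_count_gt _ nat) => //.
by rewrite size_elems ltn_ord andbT.
Qed.

Lemma pl_le_setD a b :
  {in val a :\: val b & val b :\: val a, forall x y : 'I_n, (x <= y)%N} -> pl_le a b.
Proof.
move=> ab; apply/pl_leP => i; rewrite leq_entry_card; set x := entry b i.
apply: (@leq_trans #|[set y in val b | (y <= x)%N]|); first by rewrite -leq_entry_card.
set B := [set y in val b | _]; set A := [set y in val a | _].
rewrite -(cardsID (val a) B) -(cardsID (val b) A).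
have -> : B :&: val a = A :&: val b.
  by apply/setP => y; rewrite !inE andbAC (andbC (y \in val b)) andbAC.
rewrite leq_add2l; have [->|[y]] := set_0Vmem (B :\: val a); first by rewrite cards0.
rewrite !inE => /and3P[ya yb yx].
have -> : A :\: val b = val a :\: val b.
  apply/setP => z; rewrite !inE; case: (boolP (z \in val b)) => //= zb.
  case: (boolP (z \in val a)) => //= za.
  by apply: leq_trans yx; apply: ab; rewrite inE ?za ?zb ?ya ?yb.
have -> : #|val a :\: val b| = #|val b :\: val a|.
  by rewrite !cardsD (eqP (valP a)) (eqP (valP b)) setIC.
by rewrite subset_leq_card // setSD //; apply/subsetP => z; rewrite inE => /andP[].
Qed.

End KSubsets.

Arguments entry : simpl never.

(** * Brackets and alternants *)

Section Brackets.
Variables n k : nat.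
Implicit Types (g h : 'I_k -> 'I_n) (a : ksub n k) (s : 'S_k).

Definition col_minor (R : comNzRingType) (M : 'M[R]_(k, n)) g : R := \det (colsub g M).

Lemma eq_col_minor (R : comNzRingType) (M : 'M[R]_(k, n)) g h :
  g =1 h -> col_minor M g = col_minor M h.
Proof. by move=> gh; rewrite /col_minor (eq_colsub _ gh). Qed.

Lemma col_minor_perm (R : comNzRingType) (M : 'M[R]_(k, n)) g s :
  col_minor M (g \o s) = (-1) ^+ s * col_minor M g.
Proof.
by rewrite /col_minor colsub_comp -col_permEsub col_permE det_mulmx det_perm odd_permV mulrC.
Qed.

Lemma col_minor_noninj (R : comNzRingType) (M : 'M[R]_(k, n)) g :
  ~~ injectiveb g -> col_minor M g = 0.
Proof.
case/injectivePn => x [y xy gxy]; rewrite /col_minor -det_tr.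
by apply: (determinant_alternate xy) => i; rewrite !mxE gxy.
Qed.

Variable F : fieldType.

Lemma pluckE (M : 'M[F]_(k, n)) a : pluck M a = col_minor M (entry a).
Proof.
congr (\det _); apply/matrixP => i j; rewrite !mxE.
case: insubP => [c _ ce|]; last by rewrite ltn_ent.
by congr (M i _); apply: val_inj.
Qed.

(* For an arbitrary word [g], the bracket is 0 or plus or minus a variable. *)
Definition bracket g : {mpoly F[nvars n k]} :=
  \sum_a \sum_(s : 'S_k | [forall i, g i == entry a (s i)]) (-1) ^+ s *: 'X_(Pvar a).

Lemma eq_bracket g h : g =1 h -> bracket g = bracket h.
Proof.
move=> gh; apply: eq_bigr => a _; apply: eq_bigl => s.
by apply: eq_forallb => i; rewrite gh.
Qed.

Lemma bracket_perm g s : bracket (g \o s) = (-1) ^+ s *: bracket g.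
Proof.
rewrite scaler_sumr; apply: eq_bigr => a _.
rewrite scaler_sumr (reindex_inj (mulgI s)) /=; apply: eq_big => t.
  apply/forallP/forallP => gst i; last by rewrite permM; apply: gst.
  by have := gst (s^-1%g i); rewrite permM /= permKV.
by rewrite odd_permM signr_addb scalerA.
Qed.

Lemma bracket_entry a : bracket (entry a) = 'X_(Pvar a).
Proof.
have word1 b s : [forall i, entry a i == entry b (s i)] -> a = b /\ s = 1%g.
  move=> /forallP abs; have [|-> ->] //:= @word_unique _ _ a b 1 s.
  by move=> i; rewrite /= perm1; apply/eqP.
rewrite /bracket (bigD1 a) //= (bigD1 1%g) /=; last by apply/forallP => i; rewrite perm1.
rewrite odd_perm1 scale1r big1 ?addr0 => [|s /andP[/word1[_ ->]]]; last by rewrite eqxx.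
rewrite big1 ?addr0 // => b ba; rewrite big_pred0 // => s.
by apply: contraNF ba => /word1[->].
Qed.

Lemma bracket_word g a s : g =1 entry a \o s -> bracket g = (-1) ^+ s *: 'X_(Pvar a).
Proof. by move/eq_bracket => ->; rewrite bracket_perm bracket_entry. Qed.

Lemma bracket_noninj g : ~~ injectiveb g -> bracket g = 0.
Proof.
move=> /injectiveP g_ninj; rewrite /bracket big1 // => a _; rewrite big_pred0 // => s.
apply/negP => /forallP gE; apply: g_ninj => i j gij.
by apply: (@perm_inj _ s); apply: (@entry_inj _ _ a); rewrite -(eqP (gE i)) -(eqP (gE j)).
Qed.

Lemma bracket_eval (M : 'M[F]_(k, n)) g : (bracket g).@[pluckv M] = col_minor M g.
Proof.
have [/injectiveP g_inj|g_ninj] := boolP (injectiveb g); last first.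
  by rewrite bracket_noninj // meval0 col_minor_noninj.
have [a [s gE]] := word_of_injective g_inj.
rewrite (bracket_word gE) mevalZ mevalXU /pluckv enum_rankK pluckE -col_minor_perm.
by apply: eq_col_minor => i; rewrite gE.
Qed.

End Brackets.

Lemma mpolyX_sum (R : nzRingType) (n : nat) (I : Type) (r : seq I) (P : pred I)
    (G : I -> 'X_{1..n}) :
  'X_[\sum_(i <- r | P i) G i] = \prod_(i <- r | P i) 'X_[G i] :> {mpoly R[n]}.
Proof. by apply: (big_morph (fun u => 'X_[u])); [exact: mpolyXD|exact: mpolyX0]. Qed.

Section Tableaux.
Variables n k d : nat.
Local Notation cell := ('I_d * 'I_k)%type.
Implicit Types (T : 'I_d -> ksub n k) (f : cell -> 'I_n).

Definition entries T (x : cell) : 'I_n := entry (T x.1) x.2.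

Definition tabmon T : 'X_{1..nvars n k} := (\sum_c U_(Pvar (T c)))%MM.

Lemma tabmonE T b : tabmon T (Pvar b) = (\sum_c (T c == b))%N.
Proof.
rewrite mnm_sumE; apply: eq_bigr => c _.
by rewrite mnm1E (inj_eq enum_rank_inj).
Qed.

Lemma mdeg_tabmon T : mdeg (tabmon T) = d.
Proof.
by rewrite mdeg_sum (eq_bigr (fun=> 1%N)) ?sum1_card ?card_ord // => c _; rewrite mdeg1.
Qed.

Lemma prod_col_minor (R : comNzRingType) (M : 'M[R]_(k, n)) f :
  \prod_c col_minor M (fun i => f (c, i)) =
  \sum_(h : {ffun 'I_d -> 'S_k}) (\prod_c (-1) ^+ h c) * \prod_x M (h x.1 x.2) (f x).
Proof.
under eq_bigr => c _ do rewrite /col_minor -det_tr.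
rewrite bigA_distr_bigA /=; apply: eq_bigr => h _; rewrite big_split pair_bigA /=.
by congr (_ * _); apply: eq_bigr => -[c i] _; rewrite !mxE.
Qed.

Variable F : fieldType.

Definition bracket_prod f : {mpoly F[nvars n k]} := \prod_c bracket F (fun i => f (c, i)).

Lemma eq_bracket_prod f f' : f =1 f' -> bracket_prod f = bracket_prod f'.
Proof. by move=> ff'; apply: eq_bigr => c _; apply: eq_bracket => i. Qed.

Lemma bracket_prod_entries T : bracket_prod (entries T) = 'X_[tabmon T].
Proof. by rewrite mpolyX_sum; apply: eq_bigr => c _; rewrite -bracket_entry. Qed.

Lemma bracket_prod_eval (M : 'M[F]_(k, n)) f :
  (bracket_prod f).@[pluckv M] = \prod_c col_minor M (fun i => f (c, i)).
Proof. by rewrite rmorph_prod; apply: eq_bigr => c _; exact: bracket_eval. Qed.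

Lemma bracket_prod_tperm f (x y : cell) : x != y -> x.1 = y.1 ->
  bracket_prod (f \o tperm x y) = - bracket_prod f.
Proof.
case: x y => [c i] [c' j] /= /[swap] <-{c'} xy.
have ij : i != j by apply: contraNneq xy => ->.
rewrite /bracket_prod (bigD1 c) // [in RHS](bigD1 c) //= -mulNr; congr (_ * _).
  rewrite (@eq_bracket _ _ _ _ ((fun l => f (c, l)) \o tperm i j)); last first.
    by move=> l; rewrite /= (@inj_tperm _ _ (fun l => (c, l))) // => ? ? [].
  by rewrite bracket_perm odd_tperm ij expr1 scaleN1r.
apply: eq_bigr => c' cc'; apply: eq_bracket => l /=.
by rewrite tpermD // xpair_eqE negb_and eq_sym cc'.
Qed.

Lemma msupp_bracket_prod f u : u \in msupp (bracket_prod f) ->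
  exists2 T, u = tabmon T & forall c, exists s : 'S_k, forall i, f (c, i) = entry (T c) (s i).
Proof.
have [/existsP[c /eqP z]|/existsPn nz] :=
    boolP [exists c, bracket F (fun i => f (c, i)) == 0].
  by rewrite /bracket_prod (bigD1 c) //= z mul0r msupp0.
have col_word c : exists word : ksub n k * 'S_k,
    (fun i => f (c, i)) =1 entry word.1 \o word.2.
  have [/injectiveP/word_of_injective[a [s fE]]|/bracket_noninj z] :=
    boolP (injectiveb (fun i => f (c, i))); first by exists (a, s).
  by have := nz c; rewrite z eqxx.
have [word fE] := fin_all_exists col_word.
rewrite /bracket_prod (eq_bigr _ (fun c _ => bracket_word F (fE c))) scaler_prod -mpolyX_sum.
rewrite msuppMCX ?inE; last by apply/prodf_neq0 => c _; rewrite signr_eq0.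
by move=> /eqP ->; exists (fun c => (word c).1) => // c; exists (word c).2 => i; apply: fE.
Qed.

End Tableaux.

Lemma fiber_perm_ind (T : finType) (U : eqType) (f : T -> U) (P : {perm T} -> Prop) :
  P 1%g ->
  (forall x y (s : {perm T}), x != y -> f x = f y -> P s -> P (tperm x y * s)%g) ->
  forall s : {perm T}, f \o s =1 f -> P s.
Proof.
move=> P1 Ptperm s; have [m] := ubnP #|[set x | s x != x]|.
elim: m s => // m IHm s; rewrite ltnS => moved_le_m fs.
have [/existsP[x sx]|/existsPn s1] := boolP [exists x, s x != x]; last first.
  by have -> : s = 1%g by apply/permP => x; rewrite perm1; apply/eqP/negbNE.
pose y := s^-1%g x; have sy : s y = x by rewrite permKV.
have fxy : f x = f y by rewrite -sy [LHS]fs.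
have xy : x != y by apply: contra_neq sx => xy; rewrite {1}xy.
pose s' := (tperm x y * s)%g; have s'E z : s' z = s (tperm x y z) by rewrite permM.
have -> : s = (tperm x y * s')%g by rewrite mulgA tperm2 mul1g.
have fs' : f \o s' =1 f.
  by move=> z; rewrite /= s'E [LHS]fs; case: tpermP => [->|->|].
apply: Ptperm => //; apply: IHm => //; apply: leq_trans moved_le_m.
apply: proper_card; apply/properP; split; last first.
  by exists x; rewrite !inE // s'E tpermL sy eqxx.
apply/subsetP => z; rewrite !inE s'E; apply: contra_neq => sz.
case: tpermP => // [zx|zy]; first by rewrite zx sy.
by move: xy; rewrite -zy -sz zy sy eqxx.
Qed.

Section PermAlong.
Variables (l : nat) (X : finType) (pos : 'I_l -> X).
Hypothesis pos_inj : injective pos.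

Definition perm_along (p : 'S_l) (x : X) : X :=
  if [pick i | pos i == x] is Some i then pos (p i) else x.

Lemma perm_along_pos p i : perm_along p (pos i) = pos (p i).
Proof.
rewrite /perm_along; case: pickP => [j /eqP/pos_inj ->//|/(_ i)].
by rewrite eqxx.
Qed.

Lemma perm_along_out p x : x \notin codom pos -> perm_along p x = x.
Proof.
rewrite /perm_along; case: pickP => // i /eqP <-.
by rewrite codom_f.
Qed.

Lemma perm_along1 : perm_along 1 =1 id.
Proof.
move=> x; have [/codomP[i ->]|xN] := boolP (x \in codom pos).
  by rewrite perm_along_pos perm1.
exact: perm_along_out.
Qed.

Lemma perm_along_tperm i j p :
  perm_along (tperm i j * p) =1 perm_along p \o tperm (pos i) (pos j).
Proof.
move=> x /=; have [/codomP[m ->]|xN] := boolP (x \in codom pos).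
  by rewrite -(inj_tperm _ _ _ pos_inj) !perm_along_pos permM.
by rewrite tpermD ?perm_along_out //; apply: contraNneq xN => <-; rewrite codom_f.
Qed.

Lemma sum_perm_along (R : comNzRingType) (G : X -> X -> R) :
  \sum_(p : 'S_l) (-1) ^+ p * \prod_x G x (perm_along p x) =
  (\prod_(x | x \notin codom pos) G x x) * \det (\matrix_(i, j) G (pos i) (pos j)).
Proof.
rewrite mulr_sumr; apply: eq_bigr => p _; rewrite [RHS]mulrCA; congr (_ * _).
rewrite (bigID (mem (codom pos))) [LHS]mulrC /=; congr (_ * _).
  by apply: eq_bigr => x xN; rewrite perm_along_out.
transitivity (\prod_(x in [set pos i | i : 'I_l]) G x (perm_along p x)).
  by apply: eq_bigl => x; apply/codomP/imsetP => -[i]; [exists i | move=> _; exists i].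
rewrite big_imset /=; last by move=> i j _ _ /pos_inj.
by apply: eq_bigr => i _; rewrite mxE perm_along_pos.
Qed.

End PermAlong.

Lemma mxrank_mxsub_leq (F : fieldType) m n m' n' (M : 'M[F]_(m, n))
    (g : 'I_m' -> 'I_m) (h : 'I_n' -> 'I_n) : (\rank (mxsub g h M) <= \rank M)%N.
Proof.
have rowsub_leq p q q' (A : 'M[F]_(p, q)) (f : 'I_q' -> 'I_p) :
    (\rank (rowsub f A) <= \rank A)%N by rewrite rowsubE mxrankM_maxr.
rewrite mxsubrc; apply: leq_trans (rowsub_leq _ _ _ _ _) _.
by rewrite -mxrank_tr -[leqRHS]mxrank_tr trmx_mxsub.
Qed.

Lemma det_eq0_rank (F : fieldType) n (A : 'M[F]_n) : (\rank A < n)%N -> \det A = 0.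
Proof.
apply: contraTeq => detA; rewrite -leqNgt mxrank_unit //.
by rewrite unitmxE unitfE.
Qed.

Section Alternant.
Variables (F : fieldType) (n k d l : nat).
Local Notation cell := ('I_d * 'I_k)%type.
Variables (f : cell -> 'I_n) (pos : 'I_l -> cell).
Hypothesis pos_inj : injective pos.

Definition alternant : {mpoly F[nvars n k]} :=
  \sum_(p : 'S_l) (-1) ^+ p *: bracket_prod F (f \o perm_along pos p).

Lemma alternant_eval (M : 'M[F]_(k, n)) :
  (\rank (colsub (f \o pos) M) < l)%N -> alternant.@[pluckv M] = 0.
Proof.
move=> rankM; rewrite raddf_sum /=.
under eq_bigr => p _ do
  rewrite mevalZ bracket_prod_eval (prod_col_minor M (f \o _)) mulr_sumr /=.
rewrite exchange_big big1 //= => h _.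
pose G (x y : cell) := M (h x.1 x.2) (f y).
under eq_bigr => p _ do rewrite mulrCA -/(\prod_x G x (perm_along pos p x)).
rewrite -mulr_sumr sum_perm_along // [\det _]det_eq0_rank ?mulr0 //.
apply: leq_ltn_trans rankM.
rewrite (_ : \matrix_(_, _) _ = rowsub (fun i => h (pos i).1 (pos i).2) (colsub (f \o pos) M)).
  exact: mxrank_mxsub_leq.
by apply/matrixP => i j; rewrite !mxE.
Qed.

Lemma bracket_prod_along (p : 'S_l) : (forall i, (pos (p i)).1 = (pos i).1) ->
  bracket_prod F (f \o perm_along pos p) = (-1) ^+ p *: bracket_prod F f.
Proof.
move: p; apply: (@fiber_perm_ind _ _ (fun i => (pos i).1)) => [|i j p ij col_ij IHp].
  rewrite odd_perm1 scale1r; apply: eq_bracket_prod => x.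
  by rewrite /= perm_along1.
transitivity (bracket_prod F ((f \o perm_along pos p) \o tperm (pos i) (pos j))).
  by apply: eq_bracket_prod => x; rewrite /= perm_along_tperm.
rewrite bracket_prod_tperm ?(inj_eq pos_inj) // IHp odd_mul_tperm ij.
by rewrite signr_addb expr1 mulN1r scaleNr.
Qed.

End Alternant.

(** * Leading monomials *)

Section DegRevLex.
Variables (n k : nat) (w : ksub n k -> nat).
Local Notation mon := 'X_{1..nvars n k}.
Implicit Types u v x : mon.

Lemma drl_irr u : ~ drl_lt w u u.
Proof. by case=> [|[_ [a []]]]; rewrite ltnn. Qed.

Lemma drl_addl x u v : drl_lt w u v -> drl_lt w (x + u)%MM (x + v)%MM.
Proof.
case=> [deg_lt|[deg_eq [a [lt_a eq_a]]]]; [left|right]; rewrite !mdegD ?ltn_add2l //.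
rewrite deg_eq; split=> //; exists a; split=> [|b /eq_a eq_b]; rewrite !mnmDE ?ltn_add2l //.
by rewrite eq_b.
Qed.

Lemma drl_tabmon d (T T' : 'I_d -> ksub n k) (c0 : 'I_d) :
  {homo w \o T : c c' / (c <= c')%N} ->
  (forall c : 'I_d, (c < c0)%N -> T' c = T c) -> (w (T' c0) < w (T c0))%N ->
  drl_lt w (tabmon T') (tabmon T).
Proof.
move=> wT eqT ltT; right; split; first by rewrite !mdeg_tabmon.
have [c1 c01 c1min] := @arg_minnP _ c0 (fun c : 'I_d => c0 <= c)%N (w \o T') (leqnn c0).
have wT'c1 (c : 'I_d) : (c0 <= c)%N -> (w (T' c1) < w (T c))%N.
  by move=> /wT; apply: leq_trans; apply: leq_ltn_trans (c1min c0 (leqnn _)) ltT.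
exists (T' c1); split=> [|b wb]; rewrite !tabmonE.
  rewrite (bigD1 c1) //= [X in (_ < X)%N](bigD1 c1) //= eqxx.
  have /negPf -> : T c1 != T' c1 by apply: contraTneq (wT'c1 _ c01) => ->; rewrite ltnn.
  rewrite add0n add1n ltnS; apply: leq_sum => c _.
  have [cc0|c0c] := ltnP c c0; first by rewrite (eqT c).
  by have /negPf -> : T c != T' c1 by apply: contraTneq (wT'c1 _ c0c) => ->; rewrite ltnn.
apply: eq_bigr => c _; have [cc0|c0c] := ltnP c c0; first by rewrite (eqT c).
have /negPf -> : T c != b by apply: contraTneq (wT'c1 _ c0c) => ->; rewrite -leqNgt ltnW.
by have /negPf -> : T' c != b by apply: contraTneq (c1min _ c0c) => /= ->; rewrite -ltnNge.
Qed.

Hypothesis hw : linext w.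

Lemma drl_trans u v x : drl_lt w u v -> drl_lt w v x -> drl_lt w u x.
Proof.
case=> [uv|[uv [a [lt_a eq_a]]]] [vx|[vx [b [lt_b eq_b]]]].
- by left; apply: ltn_trans vx.
- by left; rewrite -vx.
- by left; rewrite uv.
right; split; first by rewrite uv.
case: (ltngtP (w a) (w b)) => [ab|ba|/hw.1 ab].
- exists a; rewrite -eq_b //; split=> // c ca.
  by rewrite eq_a // eq_b // (ltn_trans ca).
- exists b; rewrite eq_a //; split=> // c cb.
  by rewrite eq_a ?eq_b // (ltn_trans cb).
- exists a; split=> [|c ca]; first by rewrite (ltn_trans _ lt_a) // ab.
  by rewrite eq_a // eq_b // -ab.
Qed.

Lemma drl_ind (P : mon -> Prop) :
  (forall u, (forall v, drl_lt w v u -> P v) -> P u) -> forall u, P u.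
Proof.
move=> IH u; have [D] := ubnP (mdeg u).
pose below x := [set v : bmultinom (nvars n k) D | `[< drl_lt w v x >]].
have [N] := ubnP #|below u|; elim: N u => // N IHN u; rewrite ltnS => card_u deg_u.
apply: IH => v vu; have deg_v : (mdeg v < D)%N.
  by apply: leq_ltn_trans deg_u; case: vu => [/ltnW|[->]].
apply: IHN => //; apply: leq_trans card_u; apply: proper_card; apply/properP; split.
  by apply/subsetP => x; rewrite !inE => /asboolP xv; apply/asboolP/(drl_trans xv).
by exists (BMultinom deg_v); rewrite !inE; [apply/asboolP|apply/asboolPn/drl_irr].
Qed.

End DegRevLex.

Lemma perm_first_exit (I : finType) d (f : I -> 'I_d) (p : {perm I}) :
  ~ f \o p =1 f -> exists c : 'I_d,
    (forall i, (f i < c)%N || (f (p i) < c)%N -> f (p i) = f i) /\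
    exists2 i, f i = c & (c < f (p i))%N.
Proof.
move=> moved; have {moved} [i0 fpi0] : exists i0, f (p i0) != f i0.
  apply: contrapT => fixed; apply: moved => i; apply: contrapT => /eqP fpi.
  by apply: fixed; exists i.
have [i fpi imin] := @arg_minnP _ i0 (fun i => f (p i) != f i) (val \o f) fpi0.
have below_fixed j : (f j < f i)%N -> f (p j) = f j.
  by apply: contraTeq => /imin; rewrite -leqNgt.
have below_fixedV j : (f (p j) < f i)%N -> f (p j) = f j.
  move=> fpj; pose B := [set x | f x == f (p j)].
  have pB : p \in ('N(B | 'P))%g.
    rewrite !inE; apply/subsetP => x; rewrite !inE /= apermE => /eqP fx.
    by rewrite below_fixed fx.
  by have := astabs_act j pB; rewrite !inE /= apermE eqxx => /esym/eqP.
exists (f i); split=> [j /orP[]|]; [exact: below_fixed|exact: below_fixedV|].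
exists i => //; rewrite ltn_neqAle eq_sym fpi leqNgt.
by apply: contraNN fpi => /below_fixedV ->.
Qed.

Section LeadingTerm.
Variables (F : fieldType) (n k d l : nat) (w : ksub n k -> nat).
Hypotheses (charF0 : [pchar F] =i pred0) (hw : linext w).
Variables (T : 'I_d -> ksub n k) (pos : 'I_l -> 'I_d * 'I_k).
Local Notation col i := (pos i).1.
Hypotheses (wT : {homo w \o T : c c' / (c <= c')%N})
  (entry_incr : {homo entries T \o pos : i j / (i < j)%N})
  (col_decr : {homo (fun i => col i) : i j / (i < j)%N >-> (j <= i)%N}).

Lemma entries_pos_inj : injective (entries T \o pos).
Proof.
move=> i j ij; apply: val_inj.
by case: (ltngtP i j) => // /entry_incr; rewrite ij ltnn.
Qed.

Lemma incr_pos_inj : injective pos.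
Proof. by move=> i j ij; apply: entries_pos_inj; rewrite /= ij. Qed.

Lemma ltn_entries_pos i j : (col i < col j)%N -> (entries T (pos j) < entries T (pos i))%N.
Proof.
move=> ij; apply: entry_incr; rewrite ltnNge leq_eqVlt.
apply/negP => /orP[/eqP/val_inj e|/col_decr]; last by rewrite leqNgt ij.
by rewrite e ltnn in ij.
Qed.

Section Exchange.
Variables (p : 'S_l) (T' : 'I_d -> ksub n k).
Hypothesis T'E : forall c, exists s : 'S_k, forall i,
  entries T (perm_along pos p (c, i)) = entry (T' c) (s i).

Lemma mem_exchanged c x :
  reflect (exists i, x = entries T (perm_along pos p (c, i))) (x \in val (T' c)).
Proof. by apply: (iffP idP); have [s sE] := T'E c => /(mem_word x sE). Qed.

Lemma exchanged_sub c x : x \in val (T' c) ->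
  (exists2 i, col i = c & x = entries T (pos (p i))) \/ x \in val (T c).
Proof.
move=> /mem_exchanged[q ->]; have [/codomP[i ci]|] := boolP ((c, q) \in codom pos).
  by left; exists i; rewrite -?ci // ci perm_along_pos //; exact: incr_pos_inj.
by move=> /perm_along_out ->; right; apply: mem_entry.
Qed.

Lemma exchanged_sup c x : x \in val (T c) ->
  (exists2 i, col i = c & x = entries T (pos i)) \/ x \in val (T' c).
Proof.
move=> /ksubP[q ->]; have [/codomP[i ci]|] := boolP ((c, q) \in codom pos).
  by left; exists i; rewrite -ci.
by move=> cq; right; apply/mem_exchanged; exists q; rewrite perm_along_out.
Qed.

Lemma exchanged_id c : (forall i, col i = c -> col (p i) = c) -> T' c = T c.
Proof.
move=> fixed; apply: ksub_eq_subset; apply/subsetP => x /exchanged_sub[[i ci ->]|//].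
by rewrite -(fixed i ci); apply: mem_entry.
Qed.

(* The entries entering column [c] come from later columns, so they are smaller than the
   exchanged entries leaving it. *)
Lemma exchanged_lt c i0 : (forall i, col i = c -> (c <= col (p i))%N) ->
  col i0 = c -> (c < col (p i0))%N -> (w (T' c) < w (T c))%N.
Proof.
move=> stay ci0 exit; rewrite ltn_neqAle; apply/andP; split; last first.
  apply: hw.2; apply: pl_le_setD => x y; rewrite !inE => /andP[xT xT'] /andP[yT' yT].
  have [[i ci xE]|x_in] := exchanged_sub xT'; last by rewrite x_in in xT.
  have [[j cj yE]|y_in] := exchanged_sup yT; last by rewrite y_in in yT'.
  rewrite xE yE ltnW // ltn_entries_pos // cj ltn_neqAle stay // andbT.
  by apply: contraNneq xT => /val_inj ->; rewrite xE mem_entry.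
apply/eqP => /hw.1 TT'.
have pos_i0 : (c, (pos i0).2) = pos i0 by rewrite -ci0 -surjective_pairing.
have pos_moved : perm_along pos p (pos i0) = pos (p i0).
  by rewrite perm_along_pos //; exact: incr_pos_inj.
have : entries T (pos (p i0)) \in val (T c).
  by rewrite -TT'; apply/mem_exchanged; exists (pos i0).2; rewrite pos_i0 pos_moved.
case/ksubP => q qE; have [/codomP[i ci]|cq] := boolP ((c, q) \in codom pos).
  have pi : p i0 = i by apply: entries_pos_inj; rewrite /= qE -ci.
  by rewrite pi -ci ltnn in exit.
have [s sE] := T'E c; have qi0 : q = (pos i0).2.
  apply/(@perm_inj _ s)/(@entry_inj _ _ (T' c)).
  by rewrite -!sE perm_along_out // pos_i0 pos_moved qE.
by move: cq; rewrite qi0 pos_i0 codom_f.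
Qed.

Lemma drl_exchanged : ~ (forall i, col (p i) = col i) -> drl_lt w (tabmon T') (tabmon T).
Proof.
move=> /(@perm_first_exit _ _ (fun i => col i))[c [fixed [i ci exit]]].
apply: (@drl_tabmon _ _ _ _ _ _ c) => // [b bc|].
  by apply: exchanged_id => j jb; rewrite fixed // jb bc.
apply: (exchanged_lt (i0 := i)) => // j jc; rewrite leqNgt; apply/negP => jc'.
by have := jc'; rewrite fixed ?jc' ?orbT // jc ltnn.
Qed.

End Exchange.

Lemma alternant_lead : is_lead w (alternant F (entries T) pos) (tabmon T).
Proof.
pose keeps_cols (p : 'S_l) := [forall i, col (p i) == col i].
pose term (p : 'S_l) := bracket_prod F (entries T \o perm_along pos p).
have term_kept p : keeps_cols p -> term p = (-1) ^+ p *: 'X_[tabmon T].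
  move=> /'forall_eqP kept.
  by rewrite /term bracket_prod_along ?bracket_prod_entries //; exact: incr_pos_inj.
have term_moved p u : ~~ keeps_cols p -> u \in msupp (term p) -> drl_lt w u (tabmon T).
  move=> /'forall_eqP moved /msupp_bracket_prod[T' -> T'E]; exact: drl_exchanged moved.
split.
  rewrite mcoeff_msupp raddf_sum /= (bigID keeps_cols) /=.
  rewrite [X in _ + X]big1 ?addr0 => [|p moved]; last first.
    rewrite mcoeffZ memN_msupp_eq0 ?mulr0 //.
    by apply/negP => /(term_moved _ _ moved)/drl_irr.
  rewrite (eq_bigr (fun=> 1)) => [|p kept]; last first.
    by rewrite -/(term p) term_kept // !mcoeffZ mcoeffX eqxx mulr1 -expr2 sqrr_sign.
  rewrite sumr_const ((pcharf0P F).1 charF0) -lt0n; apply/card_gt0P; exists 1%g.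
  by apply/'forall_eqP => i; rewrite perm1.
move=> u /msupp_sum_le /flattenP[_ /mapP[p _ ->]] /msuppZ_le u_term u_neq.
have [kept|moved] := boolP (keeps_cols p); last exact: term_moved u_term.
move: u_term; rewrite -/(term p) term_kept // => /msuppZ_le.
by rewrite msuppX inE => /eqP.
Qed.

End LeadingTerm.

Lemma sorted_tnth_homo (X : eqType) (R : rel X) (s : seq X) :
  reflexive R -> transitive R -> sorted R s ->
  {homo tnth (in_tuple s) : i j / (i <= j)%N >-> R i j}.
Proof.
move=> R_refl R_trans s_sorted i j ij; have x0 := tnth (in_tuple s) i.
by rewrite !(tnth_nth x0); apply: sorted_leq_nth => //; rewrite inE.
Qed.

Lemma homo_ltn_upto (R : rel nat) (f : nat -> nat) l : transitive R ->
  (forall j, (j.+1 < l)%N -> R (f j) (f j.+1)) ->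
  forall i j, (i < j)%N -> (j < l)%N -> R (f i) (f j).
Proof.
move=> R_trans Rf i; elim=> // j IHj; rewrite ltnS leq_eqVlt => /orP[/eqP -> /Rf //|ij jl].
exact: R_trans (IHj ij (ltnW jl)) (Rf _ jl).
Qed.

Section Columns.
Variables n k : nat.
Implicit Types (mo : 'X_{1..nvars n k}) (a b : ksub n k) (t : seq (ksub n k)).

Lemma count_colseq mo a : count_mem a (colseq mo) = mo (Pvar a).
Proof.
rewrite /colseq count_flatten -map_comp sumnE big_map big_enum /= (bigD1 a) //=.
rewrite count_nseq /= eqxx mul1n big1 ?addn0 // => b /negPf ba.
by rewrite count_nseq /= ba mul0n.
Qed.

Lemma mem_colseq mo a : (a \in colseq mo) = (0 < mo (Pvar a))%N.
Proof. by rewrite -has_pred1 has_count count_colseq. Qed.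

Lemma tabmon_colseq mo t : perm_eq t (colseq mo) -> tabmon (tnth (in_tuple t)) = mo.
Proof.
move=> t_mo; apply/mnmP => i; rewrite -(enum_valK i) -/(Pvar _) tabmonE.
rewrite -count_colseq -(seq.permP t_mo) -sum1_count [RHS]big_tnth [RHS]big_mkcond.
by apply: eq_bigr => c _ /=; case: (_ == enum_val i).
Qed.

Lemma nth_elems t (x : 'I_(size t) * 'I_k) :
  nth 0%N (nth [::] (map (@elems n k) t) x.1) x.2 = entries (tnth (in_tuple t)) x.
Proof.
have a0 := tnth (in_tuple t) x.1.
by rewrite (nth_map a0) //= /ent (tnth_nth a0).
Qed.

Definition in_window alpha m (x : 'I_n) : bool := (alpha <= x < alpha + m)%N.

Definition antidiagonal alpha m l d (T : 'I_d -> ksub n k) (pos : 'I_l -> 'I_d * 'I_k) : Prop :=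
  [/\ {homo (fun i => (pos i).1) : i j / (i < j)%N >-> (j <= i)%N},
      {homo (fun i => (pos i).2) : i j / (i < j)%N},
      {homo entries T \o pos : i j / (i < j)%N} &
      forall i, in_window alpha m (entries T (pos i))].

Lemma has_gadP alpha m l t : has_gad alpha m l.+1 t <->
  exists pos : 'I_l.+1 -> 'I_(size t) * 'I_k, antidiagonal alpha m (tnth (in_tuple t)) pos.
Proof.
split=> [[sig [rho /= [bound [mono [window incr]]]]]|[pos [col row incr window]]].
  have sig_lt (i : 'I_l.+1) : (sig (l - i) < size t)%N by apply: (bound _ _).1; lia.
  pose pos (i : 'I_l.+1) : 'I_(size t) * 'I_k :=
    (Ordinal (sig_lt i), Ordinal (bound i (ltn_ord i)).2).
  pose e i := nth 0%N (nth [::] (map (@elems n k) t) (sig (l - i)%N)) (rho i).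
  have pos_entry (i : 'I_l.+1) : e i = entries (tnth (in_tuple t)) (pos i).
    by rewrite -nth_elems.
  exists pos; split=> [i j ij|i j ij|i j ij|i].
  - have [il jl] := (ltn_ord i, ltn_ord j).
    by apply: (homo_ltn_upto leq_trans (fun c cl => (mono c cl).1)); lia.
  - exact: (homo_ltn_upto ltn_trans (fun c cl => (mono c cl).2)).
  - rewrite -[ltnLHS]pos_entry -[ltnRHS]pos_entry.
    exact: (homo_ltn_upto (f := e) ltn_trans incr).
  - by rewrite /in_window -pos_entry; apply: window.
exists (fun j => (pos (inord (l - j))).1 : nat), (fun j => (pos (inord j)).2 : nat) => /=.
have inordlt i j : (i < j)%N -> (j < l.+1)%N -> (@inord l i < @inord l j)%N.
  by move=> ij jl; rewrite !inordK // (ltn_trans ij).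
have entryE j : (j < l.+1)%N ->
    nth 0%N (nth [::] (map (@elems n k) t) (pos (inord (l - (l - j)))).1) (pos (inord j)).2 =
    entries (tnth (in_tuple t)) (pos (inord j)).
  by move=> jl; rewrite subKn // nth_elems.
split; first by move=> j _; rewrite !ltn_ord.
split=> [j jl|]; first by split; [apply: col|apply: row]; apply: inordlt; lia.
by split=> j jl; rewrite !entryE ?(ltnW jl) //; [exact: window|exact/incr/inordlt].
Qed.

End Columns.

Lemma colSE (F : fieldType) k n alpha m (M : 'M[F]_(k, n)) i (j : 'I_m) (c : 'I_n) :
  c = (alpha + j)%N :> nat -> colS alpha m M i j = M i c.
Proof.
move=> cE; rewrite mxE; case: insubP => [c' _ c'E|]; last by rewrite -cE ltn_ord.
by congr (M i _); apply: val_inj; rewrite c'E -cE.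
Qed.

Lemma mxrank_in_window (F : fieldType) k n alpha m l (M : 'M[F]_(k, n)) (g : 'I_l -> 'I_n) :
  (forall i, in_window alpha m (g i)) -> (\rank (colsub g M) <= \rank (colS alpha m M))%N.
Proof.
move=> g_window; have g_lt i : (g i - alpha < m)%N.
  by have := g_window i; rewrite /in_window; lia.
rewrite (_ : colsub g M = colsub (fun i => Ordinal (g_lt i)) (colS alpha m M)).
  exact: mxrank_mxsub_leq.
apply/matrixP => i j; rewrite [LHS]mxE [RHS]mxE; apply/esym/colSE => /=.
by have := g_window j; rewrite /in_window; lia.
Qed.

Section LeadMonomials.
Variables (F : fieldType) (n k : nat) (w : ksub n k -> nat).
Implicit Types (mo : 'X_{1..nvars n k}) (t : seq (ksub n k)).

Definition lead_monomial (J : {mpoly F[nvars n k]} -> Prop) mo : Prop :=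
  exists2 f, J f & is_lead w f mo.

Definition wcols mo : seq (ksub n k) := sort (relpre w leq) (colseq mo).

Lemma perm_wcols mo : perm_eq (wcols mo) (colseq mo).
Proof. exact/permPl/perm_sort. Qed.

Lemma mem_wcols mo a : (a \in wcols mo) = (0 < mo (Pvar a))%N.
Proof. by rewrite (perm_mem (perm_wcols mo)) mem_colseq. Qed.

Lemma sorted_wcols mo : sorted (relpre w leq) (wcols mo).
Proof. by apply: sort_sorted => ? ?; apply: leq_total. Qed.

Hypotheses (charF0 : [pchar F] =i pred0) (hw : linext w).
Variables alpha m r : nat.
Local Notation J := (Jideal (F := F) (n := n) (k := k) alpha m r).

Lemma alternant_lead_monomial mo t l (pos : 'I_l -> 'I_(size t) * 'I_k) :
  let T := tnth (in_tuple t) in perm_eq t (colseq mo) -> sorted (relpre w leq) t ->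
  {homo (fun i => (pos i).1) : i j / (i < j)%N >-> (j <= i)%N} ->
  {homo entries T \o pos : i j / (i < j)%N} ->
  (forall M : 'M[F]_(k, n), \rank (colS alpha m M) <= r ->
     \rank (colsub (entries T \o pos) M) < l)%N ->
  lead_monomial J mo.
Proof.
move=> T t_mo t_sorted col_decr entry_incr small_rank.
have wT : {homo w \o T : c c' / (c <= c')%N}.
  by apply: sorted_tnth_homo t_sorted => [?|? ? ?]; [apply: leqnn|apply: leq_trans].
exists (alternant F (entries T) pos); last first.
  by rewrite -(tabmon_colseq t_mo); apply: alternant_lead.
by move=> M /small_rank; apply/alternant_eval/(incr_pos_inj entry_incr).
Qed.

Lemma cond2_lead mo : cond2 alpha m r mo -> lead_monomial J mo.
Proof.
case=> _ [t [t_mo [t_sorted /has_gadP[pos [col_decr _ entry_incr window]]]]].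
apply: (alternant_lead_monomial (pos := pos) t_mo) => // [|M].
  by apply: sub_sorted t_sorted; apply: hw.2.
by move=> rankM; rewrite ltnS (leq_trans _ rankM) // mxrank_in_window.
Qed.

(* If [b_i < a_i], alternate the k+1 entries [b_1 < ... < b_i < a_i < ... < a_k]. *)
Lemma cond1_lead mo : cond1 mo -> lead_monomial J mo.
Proof.
case=> a [b [a_mo [b_mo]]].
wlog wab : a b a_mo b_mo / (w a <= w b)%N.
  move=> sym ab; case: (leqP (w a) (w b)) => [/sym|/ltnW/sym]; apply=> //.
  by rewrite /pl_comparable orbC.
rewrite negb_or => /andP[/forallPn[i0]]; rewrite -ltnNge => lt_i0 _.
pose T := tnth (in_tuple (wcols mo)).
have /tnthP[ca aE] : a \in in_tuple (wcols mo) by rewrite mem_wcols.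
have /tnthP[cb bE] : b \in in_tuple (wcols mo) by rewrite mem_wcols.
have ca_cb : (ca <= cb)%N.
  rewrite leqNgt; apply: contraTN lt_i0 => /ltnW cb_ca.
  have wba : (w b <= w a)%N.
    rewrite aE bE; apply: (sorted_tnth_homo _ _ (sorted_wcols mo) cb_ca) => [?|? ? ?].
      exact: leqnn.
    exact: leq_trans.
  by rewrite (hw.1 a b) ?ltnn //; apply/eqP; rewrite eqn_leq wab.
have row_lt (i : 'I_k.+1) : (unbump i0 i < k)%N.
  by have := ltn_ord i0; have := ltn_ord i; rewrite /unbump; lia.
pose pos (i : 'I_k.+1) := (if (i <= i0)%N then cb else ca, Ordinal (row_lt i)).
have entry_pos i :
    entries T (pos i) = entry (if (i <= i0)%N then b else a) (Ordinal (row_lt i)).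
  by rewrite /entries /pos /=; case: ifP; rewrite ?aE ?bE.
apply: (alternant_lead_monomial (pos := pos) (perm_wcols mo) (sorted_wcols mo)).
- move=> i j ij /=; case: (leqP j i0) => ji0; last by case: ifP.
  by rewrite (leq_trans (ltnW ij) ji0).
- move=> i j ij; suff: (entries T (pos i) < entries T (pos j))%N by [].
  rewrite !entry_pos; case: (leqP j i0) => [j_i0|i0_j].
    by rewrite (leq_trans (ltnW ij) j_i0) ltn_entry /= /unbump; lia.
  case: (leqP i i0) => [i_i0|i0_i]; last by rewrite ltn_entry /= /unbump; lia.
  apply: (@leq_ltn_trans (entry b i0)); first by rewrite leq_entry /= /unbump; lia.
  by apply: leq_trans lt_i0 _; rewrite -[ent a i0]/(val (entry a i0)) leq_entry /= /unbump; lia.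
by move=> M _; rewrite ltnS rank_leq_row.
Qed.

End LeadMonomials.

(** * Chains and antidiagonals *)

Lemma bounded_chain_height (X : finType) (P : pred X) (lt : rel X) r :
  (forall s : seq X, sorted lt s -> all P s -> (size s <= r)%N) ->
  exists h : X -> nat, {in P, forall x, h x < r}%N /\
    {in P &, forall x y, lt x y -> h x < h y}%N.
Proof.
move=> short.
pose ends x l := [exists s : l.-tuple X, sorted lt (rcons s x) && all P (rcons s x)].
have ends_lt x l : ends x l -> (l < r)%N.
  by case/existsP=> s /andP[s_lt s_P]; have := short _ s_lt s_P; rewrite size_rcons size_tuple.
pose h x := (\max_(l < r | ends x l) l)%N.
have ends_h x : P x -> ends x (h x).
  move=> Px; have ends0 : ends x 0 by apply/existsP; exists [tuple]; rewrite /= Px.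
  have [|l] := @eq_bigmax_cond _ [pred l : 'I_r | ends x l] val; last first.
    by rewrite inE /h => x_l ->.
  by apply/card_gt0P; exists (Ordinal (ends_lt _ _ ends0)); rewrite inE.
exists h; split=> [x /ends_h/ends_lt //|x y /ends_h/existsP[s /andP[s_lt s_P]] Py xy].
have ends_y : ends y (h x).+1.
  apply/existsP; exists [tuple of rcons s x]; rewrite all_rcons s_P (Py : P y) andbT.
  move: s_lt => /=; case: (tval s) => [|z s'] /=; first by rewrite xy.
  by rewrite !rcons_path last_rcons xy => ->.
exact: (leq_bigmax_cond (Ordinal (ends_lt _ _ ends_y))).
Qed.

Definition semistandard n k d (T : 'I_d -> ksub n k) : Prop :=
  {homo T : c c' / (c <= c')%N >-> pl_le c c'}.

Section Chains.
Variables (n k d alpha m : nat) (T : 'I_d -> ksub n k).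
Hypothesis T_sst : semistandard T.
Local Notation cell := ('I_d * 'I_k)%type.

Lemma leq_entries (x y : cell) : (x.1 <= y.1)%N -> (x.2 <= y.2)%N ->
  (entries T x <= entries T y)%N.
Proof.
move=> col row; apply: leq_trans (_ : entry (T y.1) x.2 <= _)%N; last by rewrite leq_entry.
by move/T_sst/pl_leP: col; apply.
Qed.

(* Move each cell of the chain rightwards to the rightmost column occupied by it or by
   a later cell. *)
Lemma chain_antidiagonal l (z : 'I_l -> cell) :
  {homo (fun i => (z i).2) : i j / (i < j)%N} ->
  {homo entries T \o z : i j / (i < j)%N} ->
  (forall i, in_window alpha m (entries T (z i))) ->
  exists pos : 'I_l -> cell, antidiagonal alpha m T pos.
Proof.
move=> row_incr entry_incr window.
have rightmost (i : 'I_l) : exists c : 'I_d,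
    (exists2 j : 'I_l, (i <= j)%N & c = (z j).1) /\
    (forall j : 'I_l, (i <= j)%N -> (z j).1 <= c)%N.
  have [j ij j_max] :=
    @arg_maxnP _ i (fun j : 'I_l => i <= j)%N (fun j => val (z j).1) (leqnn i).
  by exists (z j).1; split=> //; exists j.
have [c c_max] := fin_all_exists rightmost.
have row_le (i j : 'I_l) : (i <= j)%N -> ((z i).2 <= (z j).2)%N.
  by rewrite leq_eqVlt => /orP[/eqP/val_inj -> //|/row_incr/ltnW].
exists (fun i => (c i, (z i).2)); split=> [i j ij|i j /row_incr //|i j ij|i].
- have [_ ci_max] := c_max i; have [[j' jj' ->] _] := c_max j.
  exact/ci_max/(leq_trans (ltnW ij)).
- have [[i' ii' ciE] _] := c_max i; have [_ cj_max] := c_max j.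
  have [ji'|i'j] := leqP j i'.
    apply: (@leq_ltn_trans (entries T (c j, (z i).2))).
      by apply: leq_entries; rewrite //= ciE cj_max.
    by rewrite ltn_entry row_incr.
  apply: (@leq_ltn_trans (entries T (z i'))).
    by apply: leq_entries; rewrite /= ?ciE ?row_le.
  by apply: leq_trans (entry_incr _ _ i'j) _; apply: leq_entries; rewrite /= ?cj_max.
- have [[i' ii' ciE] ci_max] := c_max i; have /andP[lo _] := window i.
  have /andP[_ hi] := window i'; apply/andP; split.
    by apply: leq_trans lo _; apply: leq_entries; rewrite /= ?ci_max.
  by apply: leq_ltn_trans hi; apply: leq_entries; rewrite /= ?ciE ?row_le.
Qed.

End Chains.

Definition cell_lt n k d (T : 'I_d -> ksub n k) (x y : 'I_d * 'I_k) : bool :=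
  (x.2 < y.2)%N && (entries T x < entries T y)%N.

Lemma cell_lt_trans n k d (T : 'I_d -> ksub n k) : transitive (cell_lt T).
Proof.
move=> y x z /andP[row_xy entry_xy] /andP[row_yz entry_yz].
by rewrite /cell_lt (ltn_trans row_xy) // (ltn_trans entry_xy).
Qed.

Lemma gad_free_height n k alpha m r (t : seq (ksub n k)) :
  let T := tnth (in_tuple t) in let S := in_window alpha m \o entries T in
  semistandard T -> ~ has_gad alpha m r.+1 t ->
  exists h : 'I_(size t) * 'I_k -> nat, {in S, forall x, h x < r}%N /\
    {in S &, forall x y, cell_lt T x y -> (h x < h y)%N}.
Proof.
move=> T S T_sst no_gad; apply: bounded_chain_height => s s_lt s_S.
rewrite leqNgt; apply/negP => r_s; apply/no_gad/has_gadP.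
have [x0 _] : exists x0, x0 \in s by case: (s) r_s => // x0 s' _; exists x0; rewrite mem_head.
have z_lt (i j : 'I_r.+1) : (i < j)%N -> cell_lt T (nth x0 s i) (nth x0 s j).
  move=> ij; apply: (sorted_ltn_nth (@cell_lt_trans _ _ _ T)) => //.
    by rewrite inE (leq_trans (ltn_ord _)).
  by rewrite inE (leq_trans (ltn_ord _)).
apply: (chain_antidiagonal T_sst (z := fun i => nth x0 s i)) => [i j|i j|i].
- by move/z_lt/andP=> [].
- by move/z_lt/andP=> [].
- by apply: (all_nthP x0 s_S); apply: leq_trans r_s.
Qed.

(** * Quadrant counts *)

Section Quadrants.
Local Open Scope nat_scope.

Lemma leq_sum_eq (I : finType) (f g : I -> nat) :
  (forall i, f i <= g i) -> \sum_i g i <= \sum_i f i -> f =1 g.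
Proof.
move=> fg gf; have [le_fg eq_fg] := leqif_sum (fun i (_ : predT i) => leqif_eq (fg i)).
by have /esym/'forall_eqP := eq_fg; rewrite eqn_leq le_fg gf.
Qed.

Lemma perm_geq_id k (s : 'S_k) : (forall i : 'I_k, i <= s i) -> s = 1%g.
Proof.
move=> s_ge; apply/permP => i; rewrite perm1; apply/val_inj/esym.
apply: (leq_sum_eq (f := val) (g := val \o s)) => //.
by rewrite [leqRHS](reindex_inj (@perm_inj _ s)).
Qed.

Lemma sum_inclusion_exclusion (X : finType) (P A B : pred X) :
  \sum_(x | P x) (A x && B x) + \sum_(x | P x) 1 =
  \sum_(x | P x) A x + \sum_(x | P x) B x + \sum_(x | P x) (~~ A x && ~~ B x).
Proof. by rewrite -!big_split; apply: eq_bigr => x _; case: (A x); case: (B x). Qed.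

Lemma sum_geq_fibers (X : finType) N (P : pred X) (f : X -> 'I_N) p :
  \sum_(x | P x) (p <= f x) = \sum_(i < N | p <= i) \sum_x (P x && (f x == i)).
Proof.
rewrite exchange_big big_mkcond /=; apply: eq_bigr => x _.
rewrite big_mkcond (bigD1 (f x)) //= eqxx andbT big1 ?addn0 => [|i /negPf fx_i].
  by case: (P x); case: (p <= f x).
by rewrite eq_sym fx_i andbF; case: ifP.
Qed.

Definition quadrant (X : finType) (row col : X -> nat) p q : nat :=
  \sum_x ((p <= row x) && (q <= col x)).

(* By inclusion-exclusion, the counts of the closed south-east quadrant and of the
   opposite open north-west one differ by a constant depending on the margins only,
   and for an antichain one of them is 0. *)
Lemma leq_quadrant_antichain (L X Y : finType) k n (lx : X -> L) (ly : Y -> L)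
    (rx : X -> 'I_k) (cx : X -> 'I_n) (ry : Y -> 'I_k) (cy : Y -> 'I_n) p q :
  (forall l i, \sum_x ((lx x == l) && (rx x == i)) = \sum_y ((ly y == l) && (ry y == i))) ->
  (forall l j, \sum_x ((lx x == l) && (cx x == j)) = \sum_y ((ly y == l) && (cy y == j))) ->
  (forall x x', rx x < rx x' -> cx x < cx x' -> lx x <> lx x') ->
  quadrant rx cx p q <= quadrant ry cy p q.
Proof.
move=> eq_rows eq_cols antichain.
have eq_row_tail l p' :
    \sum_(x | lx x == l) (p' <= rx x) = \sum_(y | ly y == l) (p' <= ry y).
  by rewrite !sum_geq_fibers; apply: eq_bigr.
have eq_col_tail l q' :
    \sum_(x | lx x == l) (q' <= cx x) = \sum_(y | ly y == l) (q' <= cy y).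
  by rewrite !sum_geq_fibers; apply: eq_bigr.
rewrite /quadrant (partition_big lx xpredT) //= [leqRHS](partition_big ly xpredT) //=.
apply: leq_sum => l _.
have := sum_inclusion_exclusion (fun x => lx x == l) (fun x => p <= rx x) (fun x => q <= cx x).
have := sum_inclusion_exclusion (fun y => ly y == l) (fun y => p <= ry y) (fun y => q <= cy y).
have := eq_row_tail l p; have := eq_col_tail l q; have := eq_row_tail l 0 => /=.
case: (posnP (\sum_(x | lx x == l) ((p <= rx x) && (q <= cx x)))) => [-> //|].
rewrite lt0n sum_nat_eq0 => /forallPn[x].
rewrite negb_imply eqb0 negbK => /andP[/eqP lxl /andP[px qx]].
rewrite [X in _ -> _ -> _ -> _ -> _ = _ + X -> _]big1 => [|x' /eqP lx'l]; first lia.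
rewrite -!ltnNge; case: ltnP => //= px'; case: ltnP => //= qx'.
by case: (antichain x' x); rewrite ?lxl // ?(leq_trans px') ?(leq_trans qx').
Qed.

Lemma leq_quadrant_perm k (s : 'S_k) (c : 'I_k -> nat) p q :
  {mono c : i j / i <= j} -> quadrant (val \o s) c p q <= quadrant val c p q.
Proof.
move=> c_mono.
have [/forallP pc|/forallPn[i0]] := boolP [forall i : 'I_k, (p <= i) ==> (q <= c i)].
  rewrite /quadrant [leqRHS](eq_bigr (fun i : 'I_k => nat_of_bool (p <= i))) => [|i _].
    rewrite [leqRHS](reindex_inj (@perm_inj _ s)) /=; apply: leq_sum => i _.
    by case: (p <= s i); rewrite ?leq_b1.
  by have := pc i; case: (p <= i) => //= ->.
rewrite negb_imply -ltnNge => /andP[pi0 qi0]; apply: leq_sum => i _ /=.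
have [qi|_] := leqP q (c i); rewrite ?andbF // !andbT.
have -> : p <= i by rewrite (leq_trans pi0) // -c_mono (ltnW (leq_trans qi0 qi)).
by case: (p <= s i).
Qed.

Lemma quadrant_perm_eq1 k (s : 'S_k) (c : 'I_k -> nat) :
  {mono c : i j / i <= j} ->
  (forall p : 'I_k, quadrant (val \o s) c p (c p) = quadrant val c p (c p)) -> s = 1%g.
Proof.
move=> c_mono eq_quad; apply: perm_geq_id => p.
have diag (i : 'I_k) : (p <= i) && (c p <= c i) = (p <= i) by rewrite c_mono andbb.
have := @leq_sum_eq _ (fun i : 'I_k => nat_of_bool ((p <= s i) && (c p <= c i)))
  (fun i : 'I_k => nat_of_bool (p <= i)) _ _ p.
rewrite c_mono leqnn andbT => ps; have {ps} : nat_of_bool (p <= s p) = 1.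
  apply: ps => [i|]; first by rewrite c_mono; case: (p <= s i); case: (p <= i).
  by have := eq_quad p; rewrite /quadrant => ->; under [leqRHS]eq_bigr do rewrite diag.
by case: (p <= s p).
Qed.

Lemma homo_leq_counts_eq d (f g : 'I_d -> nat) :
  {homo f : c c' / c <= c'} -> {homo g : c c' / c <= c'} ->
  (forall q, \sum_c (q <= f c) = \sum_c (q <= g c)) -> f =1 g.
Proof.
move=> f_homo g_homo eq_counts c; wlog fg : f g f_homo g_homo eq_counts / f c < g c => [sym|].
  by case: (ltngtP (f c) (g c)) => // lt; [|apply/esym]; apply: sym.
have := eq_counts (g c); move/eqP; rewrite eqn_leq => /andP[_].
rewrite leqNgt => /negP[]; rewrite (bigD1 c) //= [ltnRHS](bigD1 c) //= leqnn.
rewrite [_ <= f c]leqNgt fg add0n add1n ltnS; apply: leq_sum => c' _.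
have [gc_fc'|//] := leqP (g c) (f c'); rewrite g_homo // leqNgt.
by apply: contraTN gc_fc' => /ltnW/f_homo fc'; rewrite -ltnNge (leq_ltn_trans fc').
Qed.

Variables n k : nat.

Definition tab_quadrant d (T : 'I_d -> ksub n k) : nat -> nat -> nat :=
  quadrant (fun x : 'I_d * 'I_k => x.2) (entries T).

Lemma quadrant_cols d (T : 'I_d -> ksub n k) (row : 'I_d -> 'I_k -> nat) p q :
  quadrant (fun x => row x.1 x.2) (entries T) p q =
  \sum_c quadrant (row c) (entry (T c)) p q.
Proof. by rewrite /quadrant pair_bigA. Qed.

Lemma tab_quadrant_rows d (T : 'I_d -> ksub n k) (i : 'I_k) q :
  tab_quadrant T i q = \sum_(c < d) (q <= entry (T c) i) + tab_quadrant T i.+1 q.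
Proof.
rewrite /tab_quadrant !(quadrant_cols _ (fun _ i => val i)) -big_split /=.
apply: eq_bigr => c _; rewrite /quadrant (bigD1 i) //= leqnn.
rewrite [X in _ = _ + X](bigD1 i) //= ltnn add0n; congr (_ + _).
by apply: eq_bigr => j ji; rewrite [i < j]ltn_neqAle eq_sym (inj_eq val_inj) ji.
Qed.

Lemma tab_quadrant_out d (T : 'I_d -> ksub n k) p q :
  (k <= p) || (n <= q) -> tab_quadrant T p q = 0.
Proof.
move=> pq; apply: big1 => x _; apply/eqP; rewrite eqb0 negb_and -!ltnNge.
by case/orP: pq => /(leq_trans (ltn_ord _)) ->; rewrite ?orbT.
Qed.

Lemma tabmon_eq_quadrant d d' (T : 'I_d -> ksub n k) (T' : 'I_d' -> ksub n k) :
  0 < k -> semistandard T -> semistandard T' ->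
  (forall (p : 'I_k) (q : 'I_n), tab_quadrant T p q = tab_quadrant T' p q) ->
  tabmon T = tabmon T'.
Proof.
move=> k_gt0 T_sst T'_sst eq_quad.
have {}eq_quad p q : tab_quadrant T p q = tab_quadrant T' p q.
  have [pk|kp] := ltnP p k; last by rewrite !tab_quadrant_out ?kp.
  have [qn|nq] := ltnP q n; last by rewrite !tab_quadrant_out ?nq ?orbT.
  exact: (eq_quad (Ordinal pk) (Ordinal qn)).
have eq_rows i q : \sum_(c < d) (q <= entry (T c) i) = \sum_(c < d') (q <= entry (T' c) i).
  apply: (@addIn (tab_quadrant T i.+1 q)).
  by rewrite -tab_quadrant_rows eq_quad [in RHS]eq_quad -tab_quadrant_rows.
have dd' : d = d' by have := eq_rows (Ordinal k_gt0) 0; rewrite !sum1_card !card_ord.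
case: d' / dd' T' T'_sst eq_rows {eq_quad} => T' T'_sst eq_rows.
apply: eq_bigr => c _; congr (U_(Pvar _))%MM; apply: eq_entry => i; apply: val_inj.
apply: (homo_leq_counts_eq (f := fun c => entry (T c) i) (g := fun c => entry (T' c) i)).
- by move=> c1 c2 /T_sst/pl_leP.
- by move=> c1 c2 /T'_sst/pl_leP.
- exact: eq_rows.
Qed.

End Quadrants.

(** * A generic matrix of bounded rank *)

Lemma base_expansion_inj B N (f g : 'I_N -> nat) :
  (forall i, f i < B)%N -> (forall i, g i < B)%N ->
  (\sum_(i < N) f i * B ^ i = \sum_(i < N) g i * B ^ i)%N -> f =1 g.
Proof.
elim: N f g => [|N IH] f g fB gB; first by move=> _ [].
have horner (h : 'I_N.+1 -> nat) : (\sum_(i < N.+1) h i * B ^ i =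
    (\sum_(i < N) h (lift ord0 i) * B ^ i) * B + h ord0)%N.
  rewrite big_ord_recl /= expn0 muln1 addnC; congr (_ + _)%N.
  by rewrite big_distrl; apply: eq_bigr => i _; rewrite /= expnSr mulnA.
rewrite !horner => fg.
have fg0 : f ord0 = g ord0.
  by have := congr1 (modn^~ B) fg; rewrite /= !modnMDl !modn_small.
move: fg; rewrite fg0 => /addIn/eqP; rewrite eqn_pmul2r; last exact: leq_ltn_trans (fB ord0).
move/eqP/IH => fg_lift i; case: (unliftP ord0 i) => [j|] -> //.
exact: (fg_lift (fun=> fB _) (fun=> gB _)).
Qed.

Section Vanishing.
Variable R : idomainType.
Hypothesis charR0 : [pchar R] =i pred0.

Lemma natr_inj_pchar0 : injective (fun i => i%:R : R).
Proof.
move=> i j; wlog ij : i j / (i <= j)%N => [sym|].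
  by case: (leqP i j) => [|/ltnW] /sym ij_inj // /esym/ij_inj.
move/eqP; rewrite eq_sym -subr_eq0 -natrB // ((pcharf0P R).1 charR0) => ji.
by apply/eqP; rewrite eqn_leq ij -subn_eq0 ji.
Qed.

Lemma poly_vanish (p : {poly R}) : (forall x, p.[x] = 0) -> p = 0.
Proof.
move=> p0; apply: (@roots_geq_poly_eq0 _ p [seq i%:R | i <- iota 0 (size p)]).
- by apply/allP => x _; rewrite /root p0.
- by rewrite map_inj_uniq ?iota_uniq //; exact: natr_inj_pchar0.
- by rewrite size_map size_iota.
Qed.

(* Kronecker substitution reduces to one variable. *)
Lemma mpoly_vanish N (p : {mpoly R[N]}) : (forall v, p.@[v] = 0) -> p = 0.
Proof.
move=> p0; pose B := msize p.
pose code (u : 'X_{1..N}) := (\sum_(i < N) u i * B ^ i)%N.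
pose q : {poly R} := \sum_(u <- msupp p) p@_u *: 'X^(code u).
have q0 : q = 0.
  apply: poly_vanish => x; rewrite -[RHS](p0 (fun i => x ^+ (B ^ i))) mevalE horner_sum.
  apply: eq_bigr => u _; rewrite hornerZ hornerXn; congr (_ * _).
  by rewrite /code -prodrXr; apply: eq_bigr => i _; rewrite -exprM mulnC.
have exponent_lt u i : u \in msupp p -> (u i < B)%N.
  by move/msize_mdeg_lt; apply: leq_ltn_trans; rewrite mdegE (bigD1 i) //= leq_addr.
apply/mpolyP => u; rewrite mcoeff0.
have [u_p|/memN_msupp_eq0 //] := boolP (u \in msupp p).
have := congr1 (fun h : {poly R} => h`_(code u)) q0; rewrite coef0 coef_sum.
rewrite (bigD1_seq u) ?msupp_uniq //= coefZ coefXn eqxx mulr1 big_seq_cond.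
rewrite big1 ?addr0 // => u' /andP[u'_p u'u]; rewrite coefZ coefXn.
case: eqP => [/base_expansion_inj uu'|]; last by rewrite mulr0.
by case/eqP: u'u; apply/mnmP => i; apply/esym/uu' => j; apply: exponent_lt.
Qed.

End Vanishing.

Section Parametrization.
Variables (F : fieldType) (n k alpha m r : nat).
Local Notation label := ('I_r + 'I_n)%type.

Definition nparams : nat := #|{: 'I_k * label + label * 'I_n}|.

Definition lvar (i : 'I_k) (l : label) : 'I_nparams := enum_rank (inl (i, l)).

Definition rvar (l : label) (j : 'I_n) : 'I_nparams := enum_rank (inr (l, j)).

(* The columns in the window are spanned by r vectors, labelled by ['I_r]; a column j
   outside of it is spanned by its own vector, labelled by [inr j]. *)
Definition admissible (j : 'I_n) (l : label) : bool :=
  match l with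
  | inl _ => in_window alpha m j
  | inr j' => (j' == j) && ~~ in_window alpha m j
  end.

Definition generic_mx : 'M[{mpoly F[nparams]}]_(k, n) :=
  \matrix_(i, j) \sum_(l | admissible j l) 'X_(lvar i l) * 'X_(rvar l j).

Lemma rank_generic_mx (v : 'I_nparams -> F) : (alpha + m <= n)%N ->
  (\rank (colS alpha m (map_mx (meval v) generic_mx)) <= r)%N.
Proof.
move=> le_n; have col_lt (j : 'I_m) : (alpha + j < n)%N.
  by apply: leq_trans le_n; rewrite ltn_add2l.
pose A : 'M[F]_(k, r) := \matrix_(i, l) v (lvar i (inl l)).
pose B : 'M[F]_(r, m) := \matrix_(l, j) v (rvar (inl l) (Ordinal (col_lt j))).
suff -> : colS alpha m (map_mx (meval v) generic_mx) = A *m B.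
  exact: leq_trans (mxrankM_maxl _ _) (rank_leq_col _).
apply/matrixP => i j; rewrite (@colSE _ _ _ _ _ _ _ _ (Ordinal (col_lt j))) // !mxE.
have jS : in_window alpha m (Ordinal (col_lt j)).
  by rewrite /in_window /= leq_addr ltn_add2l ltn_ord.
rewrite raddf_sum /= big_sumType /= [X in _ + X]big_pred0 ?addr0 => [|l]; last first.
  by rewrite jS andbF.
by rewrite (eq_bigl xpredT) //; apply: eq_bigr => l _; rewrite mevalM !mevalXU !mxE.
Qed.

Definition param_mon (X : finType) (row : X -> 'I_k) (lam : X -> label) (col : X -> 'I_n) :
    'X_{1..nparams} :=
  (\sum_x (U_(lvar (row x) (lam x)) + U_(rvar (lam x) (col x))))%MM.

Lemma param_mon_lvar (X : finType) row lam col (i : 'I_k) l :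
  param_mon row lam col (lvar i l) = (\sum_(x : X) ((lam x == l) && (row x == i)))%N.
Proof.
rewrite mnm_sumE; apply: eq_bigr => x _; rewrite mnmDE !mnm1E !(inj_eq enum_rank_inj).
by rewrite addn0 andbC.
Qed.

Lemma param_mon_rvar (X : finType) row lam col l (j : 'I_n) :
  param_mon row lam col (rvar l j) = (\sum_(x : X) ((lam x == l) && (col x == j)))%N.
Proof.
by rewrite mnm_sumE; apply: eq_bigr => x _; rewrite mnmDE !mnm1E !(inj_eq enum_rank_inj).
Qed.

Definition quadrant_weight d (T : 'I_d -> ksub n k) : nat :=
  (\sum_(pq : 'I_k * 'I_n) tab_quadrant T pq.1 pq.2)%N.

Lemma param_mon_unique d d' (T : 'I_d -> ksub n k) (T' : 'I_d' -> ksub n k)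
    (h : {ffun 'I_d' -> 'S_k}) lam lam' : (0 < k)%N -> semistandard T -> semistandard T' ->
  (forall x y, cell_lt T x y -> lam x <> lam y) ->
  param_mon (fun x => h x.1 x.2) lam' (entries T') = param_mon (fun x => x.2) lam (entries T) ->
  (quadrant_weight T' <= quadrant_weight T)%N ->
  tabmon T' = tabmon T /\ h = [ffun=> 1%g].
Proof.
move=> k_gt0 T_sst T'_sst antichain eq_mon le_weight.
pose perm_quadrant p q := quadrant (fun x => h x.1 x.2) (entries T') p q.
have le_perm p q : (tab_quadrant T p q <= perm_quadrant p q)%N.
  apply: (leq_quadrant_antichain (lx := lam) (ly := lam')) => [l i|l j|x y row entry].
  - by have := congr1 (fun u : 'X_{1..nparams} => u (lvar i l)) eq_mon; rewrite !param_mon_lvar.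
  - by have := congr1 (fun u : 'X_{1..nparams} => u (rvar l j)) eq_mon; rewrite !param_mon_rvar.
  - by apply: antichain; rewrite /cell_lt row.
have le_col p q c := leq_quadrant_perm (h c) p q (leq_entry (T' c)).
have le_tab p q : (perm_quadrant p q <= tab_quadrant T' p q)%N.
  rewrite /perm_quadrant (quadrant_cols _ (fun c i => val (h c i))).
  rewrite /tab_quadrant (quadrant_cols _ (fun _ i => val i)); apply: leq_sum => c _.
  exact: le_col.
have eq_quad (p : 'I_k) (q : 'I_n) : tab_quadrant T p q = tab_quadrant T' p q.
  apply: (leq_sum_eq (f := fun pq : 'I_k * 'I_n => tab_quadrant T pq.1 pq.2)
    (g := fun pq => tab_quadrant T' pq.1 pq.2) _ le_weight (p, q)) => pq.
  exact: leq_trans (le_perm _ _) (le_tab _ _).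
split; first by apply/esym; apply: tabmon_eq_quadrant.
apply/ffunP => c; rewrite ffunE; apply: (quadrant_perm_eq1 (leq_entry (T' c))) => p.
apply: (leq_sum_eq (le_col p (entry (T' c) p))).
rewrite -(quadrant_cols _ (fun c i => val (h c i))) -(quadrant_cols _ (fun _ i => val i)).
by rewrite -[leqLHS](eq_quad p (entry (T' c) p)); exact: le_perm.
Qed.

Lemma gad_free_labelling (t : seq (ksub n k)) :
  let T := tnth (in_tuple t) in semistandard T -> ~ has_gad alpha m r.+1 t ->
  exists lam : 'I_(size t) * 'I_k -> label,
    (forall x, admissible (entries T x) (lam x)) /\
    (forall x y, cell_lt T x y -> lam x <> lam y).
Proof.
move=> T T_sst no_gad; have [h [h_lt h_incr]] := gad_free_height T_sst no_gad.
have label_of x : exists l, admissible (entries T x) l /\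
    (if l is inl i then h x = i else l = inr (entries T x)).
  have [xS|xS] := boolP (in_window alpha m (entries T x)); last first.
    by exists (inr (entries T x)); rewrite /= eqxx.
  by exists (inl (Ordinal (h_lt x xS))).
have [lam lamP] := fin_all_exists label_of.
exists lam; split=> [x|x y xy]; first by case: (lamP x).
have [] := lamP x; have [] := lamP y; case: (lam x) => [i|i]; case: (lam y) => [j|j] //=.
  by move=> yS hy xS hx [ij]; have := h_incr x y xS yS xy; rewrite hx hy ij ltnn.
move=> _ [->] _ [->] [xy_eq].
by case/andP: xy => _; rewrite ltn_neqAle /= xy_eq eqxx.
Qed.

Lemma mcoeff_prod_minor d (T : 'I_d -> ksub n k) u :
  (\prod_c col_minor generic_mx (entry (T c)))@_u =
  \sum_(h : {ffun 'I_d -> 'S_k})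
    \sum_(lam in family (fun x : 'I_d * 'I_k => admissible (entries T x)))
      (\prod_c (-1) ^+ h c) * (param_mon (fun x => h x.1 x.2) lam (entries T) == u)%:R.
Proof.
rewrite (prod_col_minor _ (entries T)) raddf_sum; apply: eq_bigr => h _.
under [X in _ * X]eq_bigr do rewrite mxE.
rewrite bigA_distr_big_dep mulr_sumr raddf_sum; apply: eq_bigr => lam _ /=.
under [X in _ * X]eq_bigr do rewrite -mpolyXD.
rewrite -mpolyX_sum -/(param_mon _ _ _) !prodrXr -[in LHS]signr_odd -[in RHS]signr_odd.
by rewrite !mulr_sign; case: ifP; rewrite ?mcoeffN mcoeffX.
Qed.

Section LeadingCoefficient.
Hypotheses (charF0 : [pchar F] =i pred0) (k_gt0 : (0 < k)%N).
Variables (d : nat) (T : 'I_d -> ksub n k) (lam : {ffun 'I_d * 'I_k -> label}).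
Hypotheses (T_sst : semistandard T)
  (antichain : forall x y, cell_lt T x y -> lam x <> lam y).
Local Notation phi := (param_mon (fun x => x.2) lam (entries T)).

Lemma mcoeff_prod_minor_eq0 d' (T' : 'I_d' -> ksub n k) : semistandard T' ->
  (quadrant_weight T' <= quadrant_weight T)%N -> tabmon T' <> tabmon T ->
  (\prod_c col_minor generic_mx (entry (T' c)))@_phi = 0.
Proof.
move=> T'_sst le_weight neq; rewrite mcoeff_prod_minor.
rewrite big1 // => h _; rewrite big1 // => lam' _.
case: eqP => [eq_mon|]; last by rewrite mulr0.
by case: neq; have [] := param_mon_unique k_gt0 T_sst T'_sst antichain eq_mon le_weight.
Qed.

Lemma mcoeff_prod_minor_neq0 : (forall x, admissible (entries T x) (lam x)) ->
  (\prod_c col_minor generic_mx (entry (T c)))@_phi != 0.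
Proof.
move=> lam_adm; rewrite mcoeff_prod_minor (bigD1 [ffun=> 1%g]) //=.
rewrite [X in _ + X]big1 ?addr0 => [|h h1]; last first.
  rewrite big1 // => lam' _; case: eqP => [eq_mon|]; last by rewrite mulr0.
  have [_ h1E] := param_mon_unique k_gt0 T_sst T_sst antichain eq_mon (leqnn _).
  by rewrite h1E eqxx in h1.
have row1 : (fun x : 'I_d * 'I_k => ([ffun=> 1%g] : {ffun 'I_d -> 'S_k}) x.1 x.2) = snd.
  by apply/funext => x; rewrite ffunE perm1.
have sign1 : \prod_(c < d) (-1) ^+ ([ffun=> 1%g] : {ffun 'I_d -> 'S_k}) c = 1 :> F.
  by rewrite big1 // => c _; rewrite ffunE odd_perm1.
rewrite row1 sign1; under eq_bigr do rewrite mul1r.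
rewrite -natr_sum ((pcharf0P F).1 charF0) -lt0n (bigD1 lam) /= ?eqxx //.
by apply/familyP.
Qed.

End LeadingCoefficient.

End Parametrization.

Lemma seq_argmax (X : eqType) (W : X -> nat) (s : seq X) : s != [::] ->
  exists2 x, x \in s & {in s, forall y, W y <= W x}%N.
Proof.
case: s => // x0 s _; pose t := in_tuple (x0 :: s).
have [i _ i_max] := @arg_maxnP _ ord0 predT (fun i => W (tnth t i)) isT.
exists (tnth t i); first exact: mem_tnth.
by move=> y; rewrite -[_ \in _]/(y \in t) => /tnthP[j ->]; apply: i_max.
Qed.

Section Independence.
Variables (F : fieldType) (n k alpha m r : nat) (w : ksub n k -> nat).
Hypotheses (charF0 : [pchar F] =i pred0) (hw : linext w).
Implicit Type mo : 'X_{1..nvars n k}.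
Local Notation tableau mo := (tnth (in_tuple (wcols w mo))).

Lemma standardP mo : standard mo <-> ~ cond1 mo.
Proof.
split=> [mo_std [a [b [a_mo [b_mo]]]]|ncond1 a b a_mo b_mo]; first by rewrite mo_std.
by apply: contrapT => /negP ab; apply: ncond1; exists a, b.
Qed.

Lemma sorted_pl_wcols mo : standard mo -> sorted (@pl_le n k) (wcols w mo).
Proof.
move=> mo_std; apply: (sub_in_sorted (P := mem (wcols w mo))) (sorted_wcols w mo); last first.
  exact/allP.
move=> a b; rewrite !mem_wcols => a_mo b_mo /= wab.
have /orP[//|ba] := mo_std a b a_mo b_mo; suff -> : a = b by exact: pl_le_refl.
by apply: hw.1; apply/eqP; rewrite eqn_leq wab hw.2.
Qed.

Lemma semistandard_wcols mo : standard mo -> semistandard (tableau mo).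
Proof.
by move/sorted_pl_wcols; apply: sorted_tnth_homo; [exact: pl_le_refl|exact: pl_le_trans].
Qed.

Lemma gad_free_wcols mo : standard mo -> ~ cond2 alpha m r mo ->
  ~ has_gad alpha m r.+1 (wcols w mo).
Proof.
move=> mo_std ncond2 gad; apply: ncond2; split=> //; exists (wcols w mo).
by split; [exact: perm_wcols|split=> //; exact: sorted_pl_wcols].
Qed.

Lemma mevalX_pluckv (M : 'M[F]_(k, n)) mo :
  'X_[mo].@[pluckv M] = \prod_c col_minor M (entry (tableau mo c)).
Proof.
by rewrite -{1}(tabmon_colseq (perm_wcols w mo)) -bracket_prod_entries bracket_prod_eval.
Qed.

Lemma Jideal_generic (f : {mpoly F[nvars n k]}) : (alpha + m <= n)%N -> Jideal alpha m r f ->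
  \sum_(mo <- msupp f)
    f@_mo *: \prod_c col_minor (generic_mx F n k alpha m r) (entry (tableau mo c)) = 0.
Proof.
move=> le_n Jf; apply: (mpoly_vanish charF0) => v.
rewrite -[RHS](Jf _ (rank_generic_mx v le_n)) [in RHS](mpolyE f) !raddf_sum /=.
apply: eq_bigr => mo _; rewrite !mevalZ mevalX_pluckv rmorph_prod; congr (_ * _).
apply: eq_bigr => c _; rewrite /col_minor -det_map_mx; congr (\det _).
by apply/matrixP => i j; rewrite !mxE.
Qed.

Lemma Jideal_independent (f : {mpoly F[nvars n k]}) : (0 < k)%N -> (alpha + m <= n)%N ->
  Jideal alpha m r f -> {in msupp f, forall mo, ~ (cond1 mo \/ cond2 alpha m r mo)} -> f = 0.
Proof.
move=> k_gt0 le_n Jf f_std; apply/eqP; rewrite -msupp_eq0; apply/negPn/negP => f_neq0.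
have mo_std mo : mo \in msupp f -> standard mo.
  by move=> /f_std/not_orP[ncond1 _]; apply/standardP.
have [mo0 f_mo0 mo0_max] := seq_argmax (fun mo => quadrant_weight (tableau mo)) f_neq0.
have T0_sst := semistandard_wcols (mo_std _ f_mo0).
have [_ ncond2] := (not_orP _ _).1 (f_std _ f_mo0).
have T0_gad_free := gad_free_wcols (mo_std _ f_mo0) ncond2.
have [lam [lam_adm antichain]] := gad_free_labelling T0_sst T0_gad_free.
have {}antichain x y : cell_lt (tableau mo0) x y -> finfun lam x <> finfun lam y.
  by rewrite !ffunE; apply: antichain.
have := congr1 (mcoeff (param_mon (fun x => x.2) (finfun lam) (entries (tableau mo0))))
  (Jideal_generic le_n Jf).
rewrite raddf_sum mcoeff0 /= (bigD1_seq mo0) ?msupp_uniq //=.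
rewrite [X in _ + X]big_seq_cond [X in _ + X]big1 => [|mo].
  rewrite addr0 mcoeffZ => /eqP; rewrite mulf_eq0 mcoeff_eq0 f_mo0; apply/negP.
  by apply: mcoeff_prod_minor_neq0 => // x; rewrite ffunE.
move=> /andP[f_mo mo_mo0]; rewrite mcoeffZ mcoeff_prod_minor_eq0 ?mulr0 //.
- exact/semistandard_wcols/mo_std.
- exact: mo0_max.
- by rewrite !(tabmon_colseq (perm_wcols w _)); apply/eqP.
Qed.

End Independence.

(** * Initial ideals *)

Section InitialIdeal.
Variables (F : fieldType) (n k : nat) (w : ksub n k -> nat).
Hypothesis hw : linext w.
Local Notation mon := 'X_{1..nvars n k}.
Variables (J : {mpoly F[nvars n k]} -> Prop) (leading : mon -> Prop).
Hypotheses (ideal0 : J 0) (idealD : forall f g, J f -> J g -> J (f + g))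
  (idealMr : forall f g, J f -> J (f * g)).
Hypotheses (leading_lead_monomial : forall u, leading u -> lead_monomial w J u)
  (nonleading_free : forall f, J f -> {in msupp f, forall u, ~ leading u} -> f = 0).

Lemma idealZ c f : J f -> J (c *: f).
Proof. by move=> Jf; rewrite -mul_mpolyC mulrC; apply: idealMr. Qed.

Lemma reduce_poly (Q : mon -> Prop) (h : {mpoly F[nvars n k]}) :
  {in msupp h, forall u, exists2 g, J ('X_[u] - g) & {in msupp g, forall v, Q v}} ->
  exists2 g, J (h - g) & {in msupp g, forall v, Q v}.
Proof.
move=> reduceX; rewrite [h]mpolyE; have: {subset msupp h <= msupp h} by [].
elim: {1 3}(msupp h) => [|u s IH] s_h.
  by exists 0; rewrite ?big_nil ?subr0 // => v; rewrite msupp0.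
have [v v_s|g Jg gQ] := IH; first by apply: s_h; rewrite inE v_s orbT.
have [g' Jg' g'Q] := reduceX u (s_h _ (mem_head _ _)).
exists (h@_u *: g' + g); last first.
  by move=> v /msuppD_le; rewrite mem_cat => /orP[/msuppZ_le /g'Q|/gQ].
by rewrite big_cons opprD addrACA -scalerBr; apply: idealD => //; apply: idealZ.
Qed.

Definition normal_form u g : Prop :=
  J ('X_[u] - g) /\ {in msupp g, forall v, ~ leading v /\ (v = u \/ drl_lt w v u)}.

Lemma reduce_tail f u : J f -> is_lead w f u ->
  (forall v, drl_lt w v u -> exists g, normal_form v g) ->
  exists2 g, J (f@_u *: 'X_[u] + g) & {in msupp g, forall v, ~ leading v /\ drl_lt w v u}.
Proof.
move=> Jf [f_u f_lead] below; pose t := f - f@_u *: 'X_[u].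
have t_lt v : v \in msupp t -> drl_lt w v u.
  move=> t_v; apply: f_lead => [|vu].
    move: t_v => /msuppB_le; rewrite mem_cat => /orP[//|/msuppZ_le].
    by rewrite msuppX inE => /eqP ->.
  by move: t_v; rewrite vu mcoeff_msupp mcoeffB mcoeffZ mcoeffX eqxx mulr1 subrr eqxx.
have [v /t_lt vu|g Jtg g_lt] := @reduce_poly (fun v => ~ leading v /\ drl_lt w v u) t.
  have [g [Jg gP]] := below v vu; exists g => // x /gP[not_leading xv]; split=> //.
  by case: xv => [-> //|xv]; exact: drl_trans hw _ _ _ xv vu.
exists g => //; have -> : f@_u *: 'X_[u] + g = f + (-1) *: (t - g).
  by rewrite scaleN1r opprB /t opprB addrCA [f + _]addrC subrK addrC.
by apply: idealD => //; apply: idealZ.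
Qed.

Lemma normal_form_exists u : exists g, normal_form u g.
Proof.
elim/(drl_ind hw): u => u IH.
have [/leading_lead_monomial[f Jf f_lead]|not_leading] := pselect (leading u); last first.
  exists 'X_[u]; split=> [|v]; first by rewrite subrr.
  by rewrite msuppX inE => /eqP ->; split=> //; left.
have [g Jg g_lt] := reduce_tail Jf f_lead IH; exists (- (f@_u)^-1 *: g); split.
  have f_u : f@_u != 0 by rewrite -mcoeff_msupp; case: f_lead.
  rewrite scaleNr opprK -[X in X + _]scale1r -(mulVf f_u) -scalerA -scalerDr.
  exact: idealZ.
by move=> v /msuppZ_le /g_lt[not_leading vu]; split=> //; right.
Qed.

Lemma lead_monomialP u : lead_monomial w J u <-> leading u.
Proof.
split=> [[f Jf f_lead]|]; last exact: leading_lead_monomial.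
apply: contrapT => not_leading.
have [g Jg g_lt] := reduce_tail Jf f_lead (fun v _ => normal_form_exists v).
have : f@_u *: 'X_[u] + g = 0.
  apply: nonleading_free Jg _ => v /msuppD_le; rewrite mem_cat => /orP[/msuppZ_le|/g_lt[] //].
  by rewrite msuppX inE => /eqP ->.
move/(congr1 (mcoeff u)); rewrite mcoeff0 mcoeffD mcoeffZ mcoeffX eqxx mulr1.
rewrite (@memN_msupp_eq0 _ _ g) ?addr0; last by apply/negP => /g_lt[_ /drl_irr].
by move/eqP; rewrite mcoeff_eq0; case: f_lead => ->.
Qed.

Lemma lead_monomial_addl u v : lead_monomial w J u -> lead_monomial w J (v + u)%MM.
Proof.
case=> f Jf [f_u f_lead]; exists (f * 'X_[v]); first exact: idealMr.
split=> [|x]; rewrite (perm_mem (msuppMX _ _)); first by rewrite map_f.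
case/mapP=> x' f_x' -> neq; apply/drl_addl/f_lead => // x'u; apply: neq.
by rewrite x'u.
Qed.

Lemma initial_ideal_monomialP u : initial_ideal w J 'X_[u] <-> leading u.
Proof.
rewrite -lead_monomialP; split=> [[l [q [lm [lm_lead uE]]]]|[f Jf f_lead]]; last first.
  exists 1%N, (fun=> 1), (fun=> u); split; last by rewrite big_ord1 mul1r.
  move=> _; exists f; split=> //; split=> //; case: f_lead => f_u _.
  by apply: contraTneq f_u => ->; rewrite msupp0.
have /existsP[i] : [exists i, u \in msupp (q i * 'X_[lm i])].
  apply: contraT => /existsPn u_out; have := congr1 (mcoeff u) uE.
  rewrite mcoeffX eqxx raddf_sum big1 => [/eqP|i _]; first by rewrite oner_eq0.
  exact: memN_msupp_eq0.
rewrite (perm_mem (msuppMX _ _)) => /mapP[v _ ->]; rewrite addmC.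
by apply: lead_monomial_addl; have [f [Jf [_ f_lead]]] := lm_lead i; exists f.
Qed.

End InitialIdeal.

Section DefiningIdeal.
Variables (F : fieldType) (n k alpha m r : nat).
Local Notation J := (Jideal (F := F) (n := n) (k := k) alpha m r).

Lemma Jideal0 : J 0.
Proof. by move=> M _; rewrite meval0. Qed.

Lemma JidealD f g : J f -> J g -> J (f + g).
Proof. by move=> Jf Jg M rk; rewrite mevalD Jf // Jg // addr0. Qed.

Lemma JidealMr f g : J f -> J (f * g).
Proof. by move=> Jf M rk; rewrite mevalM Jf // mul0r. Qed.

End DefiningIdeal.

Theorem theorem4p2 (F : closedFieldType) (charF0 : [pchar F] =i pred0)
  (n k : nat) (hk1 : (1 <= k)%N) (hkn : (k < n)%N)
  (alpha m r : nat) (hm : (1 <= m)%N) (han : (alpha + m <= n)%N) (hr : (r < m)%N)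
  (w : ksub n k -> nat) (hw : linext w) :
  (forall mo : 'X_{1..nvars n k},
     initial_ideal w (Jideal (F:=F) alpha m r) 'X_[mo] <->
     (cond1 mo \/ cond2 alpha m r mo))
  /\
  (forall mo : 'X_{1..nvars n k},
     (initial_ideal w (Jideal (F:=F) alpha m r) 'X_[mo] /\
      forall mo' : 'X_{1..nvars n k}, (mo' <= mo)%MM -> mo' <> mo ->
        ~ initial_ideal w (Jideal (F:=F) alpha m r) 'X_[mo'])
     <->
     ((cond1 mo \/ cond2 alpha m r mo) /\
      forall mo' : 'X_{1..nvars n k}, (mo' <= mo)%MM -> mo' <> mo ->
        ~ cond1 mo' /\ ~ cond2 alpha m r mo')).
Proof.
have initialP mo : initial_ideal w (Jideal (F:=F) alpha m r) 'X_[mo] <->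
    cond1 mo \/ cond2 alpha m r mo.
  apply: (initial_ideal_monomialP (leading := fun u => cond1 u \/ cond2 alpha m r u) hw)
    => [|f g|f g|u []|f Jf f_std].
  - exact: Jideal0.
  - exact: JidealD.
  - exact: JidealMr.
  - exact: cond1_lead.
  - exact: cond2_lead.
  - exact: (Jideal_independent charF0 hw hk1 han Jf).
split=> // mo; rewrite initialP; split=> -[mo_in minimal]; split=> // mo' le neq.
  by apply/not_orP; rewrite -initialP; apply: minimal.
by rewrite initialP; apply/not_orP/minimal.
Qed.
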